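(* Let $E=\mathbb R^2$, $G=I_2(m)$ a dihedral group, and $\epsilon\in\mathbb R$. For the Lie algebra $\mathfrak u(1,1)\subset H_c(G,E)$ spanned by $E_+,E_-,H$ and the central element $\tilde Z_0=Z_0+\epsilon\sigma$, the centraliser $\mathrm{Cent}_{H_c(G,E)}(\mathfrak u(1,1))$ is generated by the central element $\tilde Z_0$ of $\mathfrak u(1,1)$ and $\mathbb C[G^J]$.
   Context: $E=\mathbb R^2$ has orthonormal basis $\xi,\eta$ and dual basis $x,y$ of $E^*$. $G=I_2(m)$ is the dihedral group of order $2m$ generated by the reflections $s_1,\dots,s_m$, where $s_j$ is the reflection in $\alpha_j=\sin(\pi j/m)\xi-\cos(\pi j/m)\eta$; put $a_j=\sin(\pi j/m)x-\cos(\pi j/m)y$. $c$ is a conjugation-invariant complex-valued function on the reflections. $H_c(G,E)$ is the quotient of $T(E_{\mathbb C}\oplus E_{\mathbb C}^* )\rtimes G$ (where $gX=(g\cdot X)g$) by the relations that elements of $E$ commute, elements of $E^*$ commute, and $[\xi',x']=\langle x',\xi'\rangle-2\sum_{j=1}^mc(s_j)\langle x',\alpha_j\rangle\langle a_j,\xi'\rangle s_j$ for $\xi'\in E$, $x'\in E^*$. Put $\sigma=\sum_{j=1}^mc(s_j)s_j$, $E_+=\frac12(x^2+y^2)$, $E_-=-\frac12(\xi^2+\eta^2)$, $H=x\xi+y\eta+1-\sigma$, $Z_0=i(x\eta-y\xi)$; these satisfy $[H,E_\pm]=\pm2E_\pm$, $[E_+,E_-]=H$. The complex structure is $J\xi=-\eta$,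 $J\eta=\xi$, and $G^J$ is the subgroup of elements of $G$ commuting with $J$. *)

(* Defs.v *)
From HB Require Import structures.
From mathcomp Require Import all_boot all_order all_algebra.
From mathcomp Require Import all_classical all_reals all_analysis.
From mathcomp Require Export complex.

Set Implicit Arguments.
Unset Strict Implicit.
Unset Printing Implicit Defensive.

Import Order.TTheory GRing.Theory Num.Theory.
Local Open Scope classical_set_scope.
Local Open Scope ring_scope.
Local Open Scope complex_scope.

(* E = R^2 is the space of columns 'cV[R]_2, its dual E^* the space of rows   *)
(* 'rV[R]_2, with pairing <x', v> = (x' *m v) 0 0; linear maps act on E by    *)
(* left multiplication.                                                       *)
Section Plane.
Variable R : realType.

Definition xiE : 'cV[R]_2 := delta_mx ord0 0.
Definition etaE : 'cV[R]_2 := delta_mx ord_max 0.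
Definition xE : 'rV[R]_2 := delta_mx 0 ord0.
Definition yE : 'rV[R]_2 := delta_mx 0 ord_max.

Definition pairing (x' : 'rV[R]_2) (v : 'cV[R]_2) : R := (x' *m v) 0 0.

(* J xi = - eta and J eta = xi *)
Definition cplxJ : 'M[R]_2 := xiE *m yE - etaE *m xE.

Definition reflection_in (alpha : 'cV[R]_2) : 'M[R]_2 :=
  1%:M - (2 / (alpha^T *m alpha) 0 0) *: (alpha *m alpha^T).

Definition alpha_ (m j : nat) : 'cV[R]_2 :=
  sin (pi * j%:R / m%:R) *: xiE - cos (pi * j%:R / m%:R) *: etaE.

Definition acov_ (m j : nat) : 'rV[R]_2 :=
  sin (pi * j%:R / m%:R) *: xE - cos (pi * j%:R / m%:R) *: yE.

Definition srefl (m j : nat) : 'M[R]_2 := reflection_in (alpha_ m j).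

Definition reflections (m : nat) : set 'M[R]_2 :=
  [set s | exists2 j : nat, (1 <= j <= m)%N & s = srefl m j].

Definition subgroup_closed (A : set 'M[R]_2) : Prop :=
  [/\ A 1%:M, forall g h, A g -> A h -> A (g *m h)
    & forall g, A g -> A (invmx g)].

(* I_2(m), the group generated by the reflections; as a set it coerces to the *)
(* type of its elements.                                                      *)
Definition dihedral (m : nat) : set 'M[R]_2 :=
  smallest subgroup_closed (reflections m).

Lemma refl_dihedral (m : nat) (j : 'I_m) : srefl m j.+1 \in dihedral m.
Proof.
by apply: mem_set; apply: sub_gen_smallest => /=; exists j.+1; rewrite ?ltn_ord.
Qed.

Definition drefl (m : nat) (j : 'I_m) : dihedral m :=
  SigSub (refl_dihedral j).

Definition conj_invariant (m : nat) (c : 'M[R]_2 -> R[i]) : Prop :=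
  forall g s, dihedral m g -> reflections m s ->
    c (g *m s *m invmx g) = c s.

(* V = E_C (+) E_C^* with the diagonal action of g; the action on the dual is *)
(* contragredient.                                                            *)
Definition phase : Type := ('cV[R[i]]_2 * 'rV[R[i]]_2)%type.
HB.instance Definition _ := GRing.Lmodule.on phase.

Definition inE (v : 'cV[R]_2) : phase := (map_mx (real_complex R) v, 0).
Definition inEdual (x' : 'rV[R]_2) : phase := (0, map_mx (real_complex R) x').

Definition act (g : 'M[R]_2) (w : phase) : phase :=
  (map_mx (real_complex R) g *m w.1,
   w.2 *m map_mx (real_complex R) (invmx g)).

End Plane.

Arguments alpha_ R m j : clear implicits.
Arguments acov_ R m j : clear implicits.
Arguments srefl R m j : clear implicits.
Arguments reflections R m : clear implicits.
Arguments dihedral R m : clear implicits.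
Arguments drefl R {m} j.

(* The rational Cherednik algebra H_c(G, E), as a quotient of the absolutely  *)
(* free C-algebra expressions on V and G: the congruence [cong] is generated  *)
(* by the axioms of unital associative C-algebras, the relations presenting   *)
(* T(V) x| G, and the commutation relations of H_c(G, E).                     *)
Section Presentation.
Variables (R : realType) (m : nat) (c : 'M[R]_2 -> R[i]).
Local Notation C := R[i].
Local Notation V := (phase R).
Local Notation G := (dihedral R m).

Inductive expr : Type :=
| Evec of V
| Egrp of G
| Eone
| Ezero
| Eadd of expr & expr
| Emul of expr & expr
| Escale of C & expr.

Definition Eopp (p : expr) : expr := Escale (-1) p.

Inductive cong : expr -> expr -> Prop :=
| cong_refl p : cong p p
| cong_sym p q : cong p q -> cong q p
| cong_trans p q r : cong p q -> cong q r -> cong p r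
| cong_add p p' q q' : cong p p' -> cong q q' -> cong (Eadd p q) (Eadd p' q')
| cong_mul p p' q q' : cong p p' -> cong q q' -> cong (Emul p q) (Emul p' q')
| cong_scale a p p' : cong p p' -> cong (Escale a p) (Escale a p')
| cong_addA p q r : cong (Eadd p (Eadd q r)) (Eadd (Eadd p q) r)
| cong_addC p q : cong (Eadd p q) (Eadd q p)
| cong_add0 p : cong (Eadd Ezero p) p
| cong_addN p : cong (Eadd (Eopp p) p) Ezero
| cong_scaleA a b p : cong (Escale a (Escale b p)) (Escale (a * b) p)
| cong_scale1 p : cong (Escale 1 p) p
| cong_scaleDr a p q :
    cong (Escale a (Eadd p q)) (Eadd (Escale a p) (Escale a q))
| cong_scaleDl a b p :
    cong (Escale (a + b) p) (Eadd (Escale a p) (Escale b p))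
| cong_mulA p q r : cong (Emul p (Emul q r)) (Emul (Emul p q) r)
| cong_mul1l p : cong (Emul Eone p) p
| cong_mul1r p : cong (Emul p Eone) p
| cong_mulDl p q r : cong (Emul (Eadd p q) r) (Eadd (Emul p r) (Emul q r))
| cong_mulDr p q r : cong (Emul p (Eadd q r)) (Eadd (Emul p q) (Emul p r))
| cong_scaleAl a p q : cong (Escale a (Emul p q)) (Emul (Escale a p) q)
| cong_scaleAr a p q : cong (Escale a (Emul p q)) (Emul p (Escale a q))
| cong_vec a (v w : V) :
    cong (Evec (a *: v + w)) (Eadd (Escale a (Evec v)) (Evec w))
| cong_grp1 (g : G) : val g = 1%:M -> cong (Egrp g) Eone
| cong_grpM (g h k : G) :
    val k = val g *m val h -> cong (Emul (Egrp g) (Egrp h)) (Egrp k)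
| cong_act (g : G) (v : V) :
    cong (Emul (Egrp g) (Evec v)) (Emul (Evec (act (val g) v)) (Egrp g))
| cong_EE (u v : 'cV[R]_2) :
    cong (Emul (Evec (inE u)) (Evec (inE v)))
         (Emul (Evec (inE v)) (Evec (inE u)))
| cong_dualdual (x' y' : 'rV[R]_2) :
    cong (Emul (Evec (inEdual x')) (Evec (inEdual y')))
         (Emul (Evec (inEdual y')) (Evec (inEdual x')))
| cong_Edual (v : 'cV[R]_2) (x' : 'rV[R]_2) :
    cong (Eadd (Emul (Evec (inE v)) (Evec (inEdual x')))
               (Eopp (Emul (Evec (inEdual x')) (Evec (inE v)))))
         (Eadd (Escale (pairing x' v)%:C Eone)
               (Eopp (Escale 2
                 (\big[Eadd/Ezero]_(j < m)
                   Escale (c (srefl R m j.+1)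
                           * (pairing x' (alpha_ R m j.+1))%:C
                           * (pairing (acov_ R m j.+1) v)%:C)
                          (Egrp (drefl R j)))))).

HB.instance Definition _ := gen_eqMixin expr.
HB.instance Definition _ := gen_choiceMixin expr.

Definition congb : rel expr := fun p q => `[< cong p q >].

Lemma congb_refl : reflexive congb.
Proof. by move=> p; apply/asboolP; exact: cong_refl. Qed.

Lemma congb_sym : symmetric congb.
Proof. by move=> p q; apply/asbool_equiv_eq; split; exact: cong_sym. Qed.

Lemma congb_trans : transitive congb.
Proof.
by move=> q p r /asboolP pq /asboolP qr; apply/asboolP; exact: cong_trans qr.
Qed.

Canonical congb_equiv := EquivRel congb congb_refl congb_sym congb_trans.

Definition cherednik : Type := {eq_quot congb}%qT.
HB.instance Definition _ := Choice.on cherednik.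
HB.instance Definition _ := EqQuotient.on cherednik.

Local Notation H := cherednik.

Definition cls (p : expr) : H := (\pi_H p)%qT.

Lemma clsP (p q : expr) : cls p = cls q <-> cong p q.
Proof.
by split=> [/eqmodP/asboolP //|pq]; apply/eqmodP/asboolP.
Qed.

Lemma clsK (h : H) : cls (repr h) = h. Proof. exact: reprK. Qed.

Lemma repr_cls (p : expr) : cong (repr (cls p)) p.
Proof. by apply/clsP; rewrite clsK. Qed.

Definition hzero : H := cls Ezero.
Definition hone : H := cls Eone.
Definition hadd (h k : H) : H := cls (Eadd (repr h) (repr k)).
Definition hmul (h k : H) : H := cls (Emul (repr h) (repr k)).
Definition hscale (a : C) (h : H) : H := cls (Escale a (repr h)).
Definition hopp (h : H) : H := hscale (-1) h.

Lemma clsD (p q : expr) : hadd (cls p) (cls q) = cls (Eadd p q).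
Proof. by apply/clsP/cong_add; exact: repr_cls. Qed.

Lemma clsM (p q : expr) : hmul (cls p) (cls q) = cls (Emul p q).
Proof. by apply/clsP/cong_mul; exact: repr_cls. Qed.

Lemma clsZ a (p : expr) : hscale a (cls p) = cls (Escale a p).
Proof. by apply/clsP/cong_scale; exact: repr_cls. Qed.

Lemma cls_ind (P : H -> Prop) : (forall p, P (cls p)) -> forall h, P h.
Proof. by move=> Pcls h; rewrite -(clsK h). Qed.

Local Ltac lift_cong :=
  repeat (let p := fresh "p" in elim/cls_ind => p);
  rewrite /hopp /hzero /hone ?(clsD, clsM, clsZ); apply/clsP; constructor.

Lemma haddA : associative hadd. Proof. by lift_cong. Qed.
Lemma haddC : commutative hadd. Proof. by lift_cong. Qed.
Lemma hadd0 : left_id hzero hadd. Proof. by lift_cong. Qed.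
Lemma haddN : left_inverse hzero hopp hadd. Proof. by lift_cong. Qed.
Lemma hmulA : associative hmul. Proof. by lift_cong. Qed.
Lemma hmul1l : left_id hone hmul. Proof. by lift_cong. Qed.
Lemma hmul1r : right_id hone hmul. Proof. by lift_cong. Qed.
Lemma hmulDl : left_distributive hmul hadd. Proof. by lift_cong. Qed.
Lemma hmulDr : right_distributive hmul hadd. Proof. by lift_cong. Qed.

Lemma hscaleA a b (h : H) : hscale a (hscale b h) = hscale (a * b) h.
Proof. by elim/cls_ind: h => p; lift_cong. Qed.
Lemma hscale1 : left_id 1 hscale. Proof. by lift_cong. Qed.
Lemma hscaleDr : right_distributive hscale hadd.
Proof. by move=> a; lift_cong. Qed.
Lemma hscaleDl (h : H) : {morph hscale^~ h : a b / a + b >-> hadd a b}.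
Proof. by elim/cls_ind: h => p a b; lift_cong. Qed.
Lemma hscaleAl a (h k : H) : hscale a (hmul h k) = hmul (hscale a h) k.
Proof. by elim/cls_ind: h => p; elim/cls_ind: k => q; lift_cong. Qed.
Lemma hscaleAr a (h k : H) : hscale a (hmul h k) = hmul h (hscale a k).
Proof. by elim/cls_ind: h => p; elim/cls_ind: k => q; lift_cong. Qed.

(* Only a pzRingType: 1 <> 0 amounts to a nonzero representation and is not   *)
(* part of the construction.                                                  *)
HB.instance Definition _ := GRing.isPzRing.Build H
  haddA haddC hadd0 haddN hmulA hmul1l hmul1r hmulDl hmulDr.

HB.instance Definition _ := GRing.Zmodule_isLmodule.Build C H
  hscaleA hscale1 hscaleDr hscaleDl.

Lemma cherednik_scalerAl a (h k : H) : a *: (h * k) = (a *: h) * k.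
Proof. exact: hscaleAl. Qed.

Lemma cherednik_scalerAr a (h k : H) : a *: (h * k) = h * (a *: k).
Proof. exact: hscaleAr. Qed.

Definition vecH (v : V) : H := cls (Evec v).
Definition grpH (g : G) : H := cls (Egrp g).

Definition hxi : H := vecH (inE (xiE R)).
Definition heta : H := vecH (inE (etaE R)).
Definition hx : H := vecH (inEdual (xE R)).
Definition hy : H := vecH (inEdual (yE R)).

Definition sigma : H := \sum_(j < m) c (srefl R m j.+1) *: grpH (drefl R j).

Definition Eplus : H := 2^-1 *: (hx ^+ 2 + hy ^+ 2).
Definition Eminus : H := - (2^-1 *: (hxi ^+ 2 + heta ^+ 2)).
Definition Hweight : H := hx * hxi + hy * heta + 1 - sigma.
Definition Z0 : H := 'i *: (hx * heta - hy * hxi).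
Definition Ztilde (eps : R) : H := Z0 + eps%:C *: sigma.

(* u(1,1) is a real Lie algebra, hence the real coefficients. *)
Definition u11 (eps : R) : set H :=
  [set h | exists a b d e : R,
    h = a%:C *: Eplus + b%:C *: Eminus + d%:C *: Hweight
        + e%:C *: Ztilde eps].

Definition centraliser (S : set H) : set H :=
  [set h | forall u, S u -> GRing.comm h u].

Definition linear_closed (A : set H) : Prop :=
  A 0 /\ forall (a : C) u v, A u -> A v -> A (a *: u + v).

Definition subalgebra (A : set H) : Prop :=
  [/\ linear_closed A, A 1 & forall u v, A u -> A v -> A (u * v)].

Definition linear_span (S : set H) : set H := smallest linear_closed S.

Definition generated_algebra (S : set H) : set H := smallest subalgebra S.

Definition group_algebra_GJ : set H :=
  linear_span [set h | exists2 g : G,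
    val g *m cplxJ R = cplxJ R *m val g & h = grpH g].

End Presentation.

Arguments u11 {R} m c eps.
Arguments Ztilde {R} m c eps.
Arguments group_algebra_GJ {R} m c.

(* Main.v *)
Require Import Defs.
From mathcomp Require Import all_boot all_order all_algebra.
From mathcomp Require Import all_classical all_reals all_analysis.
From mathcomp Require Import perm ring lra zify.
From mathcomp Require Import finmap.
From mathcomp Require Import -(notations) mpoly.

(** The algebra [H] is filtered by the length of words in the letters [x], [y],
    [xi], [eta], the group algebra being its part of degree zero. The proof
    finds the elements commuting with [E_+] and [E_-] by looking at their terms
    of top degree, and then selects those commuting with [Z0 + eps sigma].

    Terms of top degree are well defined by the Poincare-Birkhoff-Witt theorem
    [filtration_top]. It comes from a representation of [H] on the functions
    from [G] to the polynomials in [x], [y], [xi], [eta]: the group acts by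
    right translation, covectors by multiplication, and vectors by Dunkl
    operators to which the multiplication by the vector is added. These
    operators commute ([dunkl_comm]) and satisfy the other relations
    ([interp_cong]). Applied to the indicator function of the neutral element,
    an element of [H] yields its [normal_form], in which a group element
    followed by a word has the corresponding monomial as its leading term.

    By [Eplus_letter] and [Eminus_letter], the brackets of [E_+] and [E_-] with
    letters are again combinations of letters, without reflections, since the
    reflections involved anticommute with their roots. Hence [E_+] and [E_-]
    act on terms of top degree as derivations of polynomials
    ([bracket_symbol]), namely, up to sign, [x d/dxi + y d/deta] and
    [xi d/dx + eta d/dy]. The polynomials killed by both are the invariants of
    [SL_2] on two copies of its standard representation, which are the
    polynomials in [x eta - y xi], the symbol of [Z0] up to the factor [i]; this
    is read off the coefficients in [invariant_top]. As [Z0] and the group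
    commute with [E_+] and [E_-], subtracting multiples of powers of [Z0] and
    descending on the degree shows that the centraliser of [E_+] and [E_-]
    consists of the sums of [z_l Z0^l] with [z_l] in the group algebra
    ([sl2_central_Z0_polys]).

    Rotations commute with [Z0], reflections anticommute with it ([grp_Z0]), and
    the group commutes with [sigma]. Let [h] be such a sum, with leading term
    [z Z0^n], and let [z = r + f] be the decomposition of [z] into rotations and
    reflections. The bracket of [Z0 + eps sigma] with [h] has leading term
    [-2 f Z0^(n+1)]; if it vanishes, then [f = 0], the powers of [Z0] being
    independent ([Z0_polys_independent]). Since [r] lies in the algebra of
    [G^J], the difference [h - r (Z0 + eps sigma)^n] commutes with
    [Z0 + eps sigma] too, and has smaller degree in [Z0]: induction concludes
    ([Ztilde_central_generated]). Conversely the generators commute with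
    [E_+], [E_-] and [Z0 + eps sigma], hence with [H = [E_+, E_-]]. *)

Set Implicit Arguments.
Unset Strict Implicit.
Unset Printing Implicit Defensive.

Import Order.TTheory GRing.Theory Num.Theory.
Local Open Scope classical_set_scope.
Local Open Scope ring_scope.
Local Open Scope complex_scope.

(** * The reflections and the roots of the dihedral group *)

Section Coordinates.
Variable S : pzRingType.

Lemma ord_max_I2 : (ord_max : 'I_2) = 1. Proof. exact: val_inj. Qed.

Lemma forall_I2 (P : 'I_2 -> Prop) : P 0 -> P 1 -> forall i, P i.
Proof.
move=> P0 P1 i; have [->|->] // : i = 0 \/ i = 1.
by case: i => [[|[|k]] lti]; [left; exact: val_inj|right; exact: val_inj|].
Qed.

Lemma sum_I2 (V : nmodType) (F : 'I_2 -> V) : \sum_i F i = F 0%R + F 1%R.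
Proof. by rewrite big_ord_recl big_ord1; congr (_ + F _); exact: val_inj. Qed.

Lemma mulmx_I2 n p (A : 'M[S]_(n, 2)) (B : 'M[S]_(2, p)) i j :
  (A *m B) i j = A i 0 * B 0 j + A i 1 * B 1 j.
Proof. by rewrite mxE sum_I2. Qed.

Lemma eq_mx2 (A B : 'M[S]_2) :
  A 0 0 = B 0 0 -> A 0 1 = B 0 1 -> A 1 0 = B 1 0 -> A 1 1 = B 1 1 -> A = B.
Proof.
by move=> e00 e01 e10 e11; apply/matrixP; do 2!apply: forall_I2.
Qed.

Lemma eq_cV2 (u v : 'cV[S]_2) : u 0 0 = v 0 0 -> u 1 0 = v 1 0 -> u = v.
Proof.
by move=> e0 e1; apply/colP; apply: forall_I2.
Qed.

Lemma eq_rV2 (u v : 'rV[S]_2) : u 0 0 = v 0 0 -> u 0 1 = v 0 1 -> u = v.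
Proof.
by move=> e0 e1; apply/rowP; apply: forall_I2.
Qed.

End Coordinates.

Section Geometry.
Variable R : realType.
Implicit Types (g h : 'M[R]_2) (a : 'cV[R]_2).

Lemma reflection_inN a : reflection_in (- a) = reflection_in a.
Proof. have aN : (- a)^T = - a^T by rewrite linearN.
by rewrite /reflection_in aN mulNmx !mulmxN mulNmx !opprK. Qed.

Lemma reflection_unit a : a^T *m a = 1%:M ->
  reflection_in a = 1%:M - 2 *: (a *m a^T).
Proof. by move=> a1; rewrite /reflection_in a1 mxE eqxx divr1. Qed.

Lemma trmx_reflection a : (reflection_in a)^T = reflection_in a.
Proof. by rewrite /reflection_in linearB linearZ /= trmx1 trmx_mul trmxK. Qed.

Lemma reflection_vec a : a^T *m a = 1%:M -> reflection_in a *m a = - a.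
Proof.
move=> a1; rewrite reflection_unit// mulmxBl mul1mx -scalemxAl -mulmxA a1 mulmx1.
by rewrite scaler_nat mulr2n opprD addrA subrr add0r.
Qed.

Lemma reflectionK a : a^T *m a = 1%:M ->
  reflection_in a *m reflection_in a = 1%:M.
Proof.
move=> a1; rewrite [X in _ *m X]reflection_unit// mulmxBr mulmx1 -scalemxAr mulmxA.
by rewrite reflection_vec// mulNmx scalerN opprK reflection_unit// subrK.
Qed.

Definition orthogonal g := g^T *m g = 1%:M.

Lemma orthogonal_inv g : orthogonal g -> invmx g = g^T.
Proof.
move=> gO; have [_ gU] := mulmx1_unit gO.
by rewrite -[RHS]mulmx1 -(mulmxV gU) mulmxA gO mul1mx.
Qed.

Lemma orthogonal_trV g : orthogonal g -> g *m g^T = 1%:M.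
Proof. exact: mulmx1C. Qed.

Lemma reflection_conj g a : orthogonal g ->
  g *m reflection_in a *m invmx g = reflection_in (g *m a).
Proof.
move=> gO; rewrite orthogonal_inv// /reflection_in mulmxBr mulmxBl mulmx1.
rewrite orthogonal_trV// -scalemxAr -scalemxAl trmx_mul -!mulmxA.
by rewrite (mulmxA g^T g) gO mul1mx.
Qed.

Lemma cplxJE : [/\ cplxJ R 0 0 = 0, cplxJ R 0 1 = 1, cplxJ R 1 0 = -1
  & cplxJ R 1 1 = 0].
Proof.
rewrite /cplxJ /xiE /etaE /xE /yE ord_max_I2.
by split; rewrite !mxE !big_ord1 !mxE /=; ring.
Qed.

(** The two components of the orthogonal group: [e] is the determinant. *)
Definition isometry_of_sign (e : R) g :=
  [/\ g 1 1 = e * g 0 0, g 1 0 = - e * g 0 1 & g 0 0 ^+ 2 + g 0 1 ^+ 2 = 1].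

Lemma isometry_of_signP g : orthogonal g ->
  exists2 e, e ^+ 2 = 1 & isometry_of_sign e g.
Proof.
move=> gO.
have := orthogonal_trV gO => gO'.
have e1 i j : (g *m g^T) i j = (1%:M : 'M[R]_2) i j by rewrite gO'.
have e2 i j : (g^T *m g) i j = (1%:M : 'M[R]_2) i j by rewrite gO.
have := e1 0 0; have := e1 0 1; have := e1 1 1; have := e2 0 0.
have := e2 0 1; have := e2 1 1; rewrite !mulmx_I2 !mxE /=.
set a := g 0 0; set b := g 0 1; set c := g 1 0; set d := g 1 1.
move=> h1 h2 h3 h4 h5 h6; exists (a * d - b * c); last split=> //.
- have -> : (a * d - b * c) ^+ 2 = (a * a + c * c) * (b * b + d * d) - (a * b + c * d) ^+ 2 by ring.
  by rewrite h1 h2 h3; ring.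
- have -> : (a * d - b * c) * a = d * (a * a + b * b) - b * (a * c + b * d) by ring.
  by rewrite h5 h6 mulr1 mulr0 subr0.
- rewrite -/b.
  have -> : - (a * d - b * c) * b = c * (a * a + b * b) - a * (a * c + b * d) by ring.
  by rewrite h5 h6 mulr1 mulr0 subr0.
Qed.

Lemma sqr1_cases (e : R) : e ^+ 2 = 1 -> e = 1 \/ e = -1.
Proof. by move/eqP; rewrite sqrf_eq1 => /orP[]/eqP; [left|right]. Qed.

(** [J] is a quarter turn: it commutes with the rotations and anticommutes
    with the reflections of the plane. *)
Lemma commute_cplxJ e g : e ^+ 2 = 1 -> isometry_of_sign e g ->
  g *m cplxJ R = cplxJ R *m g <-> e = 1.
Proof.
move=> e1 [g11 g10 n1]; have [J00 J01 J10 J11] := cplxJE; split=> [gJ|e_1]; last first.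
  rewrite e_1 in g11 g10.
  by apply: eq_mx2; rewrite !mulmx_I2 ?J00 ?J01 ?J10 ?J11 ?g11 ?g10; ring.
have [//|e_1] := sqr1_cases e1.
have /(congr1 (fun M : 'M[R]_2 => M 0 1)) := gJ.
have /(congr1 (fun M : 'M[R]_2 => M 0 0)) := gJ.
rewrite !mulmx_I2 ?J00 ?J01 ?J10 ?J11 g11 g10 e_1 => h1 h2.
have g01 : g 0 1 = 0 by lra.
have g00 : g 0 0 = 0 by lra.
by move: n1; rewrite g00 g01 => n1; lra.
Qed.

End Geometry.

Section Dihedral.
Variables (R : realType) (m : nat).
Implicit Types (g h : 'M[R]_2) (i j k : nat) (t : R).

Definition root_at t : 'cV[R]_2 := sin t *: xiE R - cos t *: etaE R.

Local Notation ang j := (pi * j%:R / m%:R : R).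

Lemma root_atE t : root_at t 0 0 = sin t /\ root_at t 1 0 = - cos t.
Proof. by rewrite /root_at /xiE /etaE ord_max_I2; split; rewrite !mxE /=; ring. Qed.

Lemma root_at_unit t : (root_at t)^T *m root_at t = 1%:M.
Proof.
have [a0 a1] := root_atE t.
rewrite [LHS]mx11_scalar mulmx_I2 ![_^T _ _]mxE a0 a1; congr (_%:M).
by rewrite mulrNN -!expr2 addrC cos2Dsin2.
Qed.

Lemma root_atDpi t : root_at (t + pi) = - root_at t.
Proof. by rewrite /root_at sinDpi cosDpi !scaleNr -opprD. Qed.

Lemma reflection_root_at t u :
  reflection_in (root_at t) *m root_at u = - root_at (2 * t - u).
Proof.
rewrite reflection_unit ?root_at_unit// mulmxBl mul1mx -scalemxAl -mulmxA.
have [t0 t1] := root_atE t; have [u0 u1] := root_atE u.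
have [v0 v1] := root_atE (2 * t - u).
have cs := cos2Dsin2 t.
rewrite mulr_natl sinB cosB sin_mulr2n cos_mulr2n in v0 v1.
have E (a v : 'cV[R]_2) (i : 'I_2) : (v - 2 *: (a *m (a^T *m v))) i 0 =
    v i 0 - 2 * (a i 0 * (a 0 0 * v 0 0 + a 1 0 * v 1 0)).
  by rewrite !mxE big_ord1 !mxE sum_I2 !mxE.
have N (i : 'I_2) : (- root_at (t *+ 2 - u)) i 0 = - root_at (t *+ 2 - u) i 0 by rewrite mxE.
have {}cs : sin t ^+ 2 = 1 - cos t ^+ 2 by rewrite -cs addrC addKr.
apply: eq_cV2; rewrite mulr_natl E N.
- by rewrite v0 t0 t1 u0 u1; ring: cs.
- by rewrite v1 t0 t1 u0 u1; ring: cs.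
Qed.

Lemma alphaE j : alpha_ R m j = root_at (ang j). Proof. by []. Qed.

Lemma acovE j : acov_ R m j = (alpha_ R m j)^T.
Proof.
by rewrite /acov_ /alpha_ linearB !linearZ /= /xiE /etaE /xE /yE !trmx_delta.
Qed.

Lemma alpha_unit j : (alpha_ R m j)^T *m alpha_ R m j = 1%:M.
Proof. by rewrite alphaE root_at_unit. Qed.

Lemma srefl_orthogonal j : orthogonal (srefl R m j).
Proof. by rewrite /orthogonal trmx_reflection reflectionK//; exact: alpha_unit. Qed.

Definition permutes_roots g := forall j, (1 <= j <= m)%N ->
  exists2 k, (1 <= k <= m)%N &
  exists2 e : R, e ^+ 2 = 1 & g *m alpha_ R m j = e *: alpha_ R m k.

(** The reflection of index [i] sends the root of index [j] to minus that of
    index [2 i - j]; shifting an index by [m] adds [pi] to the angle, which only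
    changes the sign of the root. *)
Lemma srefl_permutes_roots i : (1 <= i <= m)%N -> permutes_roots (srefl R m i).
Proof.
move=> /andP[i1 im] j /andP[j1 jm].
have m0 : m%:R != 0 :> R by rewrite pnatr_eq0 -lt0n; lia.
have E k : (k + j = 2 * i)%N -> srefl R m i *m alpha_ R m j = -1 *: alpha_ R m k.
  move=> kE; rewrite reflection_root_at scaleN1r alphaE; congr (- root_at _).
  have -> : (k%:R : R) = 2 * i%:R - j%:R by rewrite -natrM -kE natrD addrK.
  by field.
case: (ltnP j (2 * i)) => [ji|ij]; last first.
  exists (2 * i + m - j)%N; first by lia.
  exists 1; rewrite ?expr1n// scale1r reflection_root_at -root_atDpi alphaE.
  congr root_at; rewrite natrB ?natrD ?natrM; last lia.
  by field.
have [le_m|gt_m] := leqP (2 * i - j) m.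
  exists (2 * i - j)%N; first by lia.
  by exists (-1); rewrite ?sqrrN ?expr1n//; apply: E; lia.
exists (2 * i - j - m)%N; first by lia.
exists 1; rewrite ?expr1n// scale1r reflection_root_at.
transitivity (- root_at (ang (2 * i - j - m)%N + pi)); last first.
  by rewrite root_atDpi opprK.
congr (- root_at _).
by rewrite !natrB ?natrM; [field|lia|lia].
Qed.

(** The clause on [invmx g] is what makes the conjunction stable under
    inversion. *)
Lemma dihedral_props g : dihedral R m g ->
  [/\ orthogonal g, permutes_roots g & permutes_roots (invmx g)].
Proof.
move: g; apply: smallest_sub; last first.
  move=> _ [j jm ->]; split; first exact: srefl_orthogonal.
    exact: srefl_permutes_roots.
  rewrite orthogonal_inv; last exact: srefl_orthogonal.
  by rewrite trmx_reflection; exact: srefl_permutes_roots.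
have perm1 : permutes_roots 1%:M.
  by move=> j jm; exists j => //; exists 1; rewrite ?expr1n ?mul1mx ?scale1r.
have permM g h : permutes_roots g -> permutes_roots h -> permutes_roots (g *m h).
  move=> gP hP j /hP[k /gP[l lm [e e1 gk]] [f f1 hj]].
  exists l => //; exists (f * e); first by rewrite exprMn e1 f1 mulr1.
  by rewrite -mulmxA hj -scalemxAr gk scalerA.
split=> [|g h [gO gP gV] [hO hP hV]|g [gO gP gV]].
- by rewrite invmx1; split=> //; rewrite /orthogonal trmx1 mulmx1.
- split; [|exact: permM|].
    by rewrite /orthogonal trmx_mul mulmxA -(mulmxA h^T) gO mulmx1.
  have -> : invmx (g *m h) = invmx h *m invmx g; last exact: permM.
    have ghO : orthogonal (g *m h).
      by rewrite /orthogonal trmx_mul mulmxA -(mulmxA h^T) gO mulmx1.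
    by rewrite !orthogonal_inv// trmx_mul.
- by rewrite invmxK; split; rewrite // /orthogonal orthogonal_inv// trmxK orthogonal_trV.
Qed.

Lemma dihedral_orthogonal g : dihedral R m g -> orthogonal g.
Proof. by case/dihedral_props. Qed.

(** The angles of two roots differ by less than [pi], so that the sine of the
    difference, which is the determinant of the two roots, is not zero. *)
Lemma alpha_inj (i j : nat) (e : R) : (1 <= i <= m)%N -> (1 <= j <= m)%N ->
  alpha_ R m i = e *: alpha_ R m j -> i = j.
Proof.
wlog ij : i j e / (i <= j)%N => [hwlog im jm ij|/andP[i1 im] /andP[j1 jm] ijE].
  have /orP[] := leq_total i j => ?; first exact: hwlog ij.
  apply/esym/(hwlog _ _ e) => //; rewrite ij scalerA.
  have := alpha_unit i; rewrite {1}ij linearZ /= -scalemxAl ij -scalemxAr.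
  rewrite alpha_unit scalerA => /(congr1 (fun M : 'M[R]_1 => M 0 0)).
  by rewrite !mxE mulr1 => ->; rewrite scale1r.
apply/eqP; rewrite eqn_leq ij leqNgt; apply/negP => lt_ij.
have : 0 < sin (ang j - ang i).
  apply: sin_gt0_pi; rewrite -mulrBl -mulrBr -natrB//.
  have pi0 : 0 < pi :> R := pi_gt0 R.
  have m0 : 0 < m%:R :> R by rewrite ltr0n; lia.
  apply/andP; split; first by rewrite divr_gt0// mulr_gt0// ltr0n subn_gt0.
  by rewrite ltr_pdivrMr// ltr_pM2l// ltr_nat; lia.
have [sE cE] : alpha_ R m i 0 0 = sin (ang i) /\ alpha_ R m i 1 0 = - cos (ang i).
  exact: root_atE.
have [j0 j1'] : alpha_ R m j 0 0 = sin (ang j) /\ alpha_ R m j 1 0 = - cos (ang j).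
  exact: root_atE.
rewrite ijE mxE j0 in sE; rewrite ijE mxE j1' in cE.
have {}cE : cos (ang i) = e * cos (ang j) by lra.
by rewrite sinB -sE cE [X in _ < X](_ : _ = 0) ?ltxx //; ring.
Qed.

End Dihedral.

Section RootPermutation.
Variables (R : realType) (m : nat).
Local Notation G := (dihedral R m).
Implicit Types g h : G.

Lemma dihedralP g : dihedral R m (val g).
Proof. exact/set_mem/(valP g). Qed.

Definition orthG g : orthogonal (val g) := dihedral_orthogonal (dihedralP g).

Lemma mulG_subproof g h : val g *m val h \in dihedral R m.
Proof.
apply/mem_set => A AP; have [[_ AM _] _] := AP.
by apply: AM; [exact: (dihedralP g)|exact: (dihedralP h)].
Qed.

Definition mulG g h : G := SigSub (mulG_subproof g h).

Lemma oneG_subproof : 1%:M \in dihedral R m.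
Proof. by apply/mem_set => A [[A1 _ _] _]. Qed.

Definition oneG : G := SigSub oneG_subproof.

Lemma invG_subproof g : invmx (val g) \in dihedral R m.
Proof.
apply/mem_set => A AP; have [[_ _ AV] _] := AP.
by apply: AV; exact: (dihedralP g).
Qed.

Definition invG g : G := SigSub (invG_subproof g).

Lemma mulGA g h k : mulG g (mulG h k) = mulG (mulG g h) k.
Proof. by apply: val_inj; rewrite /= mulmxA. Qed.

Lemma mulG1 g : mulG g oneG = g. Proof. by apply: val_inj; rewrite /= mulmx1. Qed.

Lemma mul1G g : mulG oneG g = g. Proof. by apply: val_inj; rewrite /= mul1mx. Qed.

Lemma unitG g : val g \in unitmx.
Proof. by have [] := mulmx1_unit (orthG g). Qed.

Lemma mulGV g : mulG g (invG g) = oneG.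
Proof. by apply: val_inj; rewrite /= mulmxV ?unitG. Qed.

Lemma mulVG g : mulG (invG g) g = oneG.
Proof. by apply: val_inj; rewrite /= mulVmx ?unitG. Qed.

(** Sums over the reflections are compared with their images under [g] by
    reindexing along this permutation. *)
Lemma root_permutation g : exists p : {perm 'I_m}, exists2 e : 'I_m -> R,
  forall j, e j ^+ 2 = 1 & forall j : 'I_m,
    val g *m alpha_ R m j.+1 = e j *: alpha_ R m (p j).+1.
Proof.
have [_ gP _] := dihedral_props (dihedralP g).
have /choice[p pP] : forall j : 'I_m, exists k : 'I_m, exists2 e : R, e ^+ 2 = 1 &
    val g *m alpha_ R m j.+1 = e *: alpha_ R m k.+1.
  move=> j; have [|[//|k] km [e e1 E]] := gP j.+1; first by rewrite ltn_ord.
  by exists (Ordinal km), e.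
have /choice[e eP] : forall j : 'I_m, exists e : R, e ^+ 2 = 1 /\
    val g *m alpha_ R m j.+1 = e *: alpha_ R m (p j).+1.
  by move=> j; have [e e1 E] := pP j; exists e.
have p_inj : injective p.
  move=> i j pij; have [ei iE] := eP i; have [ej jE] := eP j.
  apply/val_inj/succn_inj.
  apply: (@alpha_inj R m _ _ (e i * e j)); rewrite ?ltn_ord//.
  rewrite -[LHS]mul1mx -(mulVmx (unitG g)) -mulmxA iE pij.
  have -> : alpha_ R m (p j).+1 = e j *: (val g *m alpha_ R m j.+1).
    by rewrite jE scalerA -expr2 ej scale1r.
  by rewrite scalerA -scalemxAr mulmxA mulVmx ?unitG// mul1mx.
exists (perm p_inj), e => j; first by have [] := eP j.
by rewrite permE; have [] := eP j.
Qed.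

Lemma drefl_conj g (j k : 'I_m) (e : R) : e ^+ 2 = 1 ->
  val g *m alpha_ R m j.+1 = e *: alpha_ R m k.+1 ->
  mulG g (drefl R j) = mulG (drefl R k) g.
Proof.
move=> e1 gj; apply: val_inj => /=.
rewrite -[LHS]mulmx1 -(mulVmx (unitG g)) mulmxA; congr (_ *m _).
rewrite reflection_conj; last exact: orthG.
rewrite gj; have [->|->] := sqr1_cases e1; first by rewrite scale1r.
by rewrite scaleN1r reflection_inN.
Qed.

Lemma conj_invariant_root (c : 'M[R]_2 -> R[i]) g (j k : 'I_m) (e : R) :
  conj_invariant m c -> e ^+ 2 = 1 ->
  val g *m alpha_ R m j.+1 = e *: alpha_ R m k.+1 ->
  c (srefl R m k.+1) = c (srefl R m j.+1).
Proof.
move=> c_inv e1 gj.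
rewrite -(c_inv (val g) (srefl R m j.+1)); [|exact: dihedralP|].
  congr c; have /(congr1 val) /= -> := drefl_conj e1 gj.
  by rewrite -mulmxA mulmxV ?unitG// mulmx1.
by exists j.+1; rewrite ?ltn_ord.
Qed.

End RootPermutation.

(** * Polynomials in four letters and divided differences *)

Section PolynomialRing.
Variable F : fieldType.
Implicit Types (i j : 'I_4) (k : multinom 4) (a : F).

Definition below_degree (T : Type) (coef : multinom 4 -> T -> F) (n : nat) (f : T) :=
  forall k, (n <= mdeg k)%N -> coef k f = 0.

(** Polynomials in four letters, standing for [x], [y], [xi], [eta] in this
    order, described by their coefficients, partial derivatives and
    substitutions. Working over an arbitrary such description keeps terms from
    being compared through the construction of polynomials. *)
Record polynomial_ring := PolynomialRing {
  poly_sort :> idomainType;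
  scal : {rmorphism F -> poly_sort};
  var : 'I_4 -> poly_sort;
  pcoef : multinom 4 -> {additive poly_sort -> F};
  pderiv : 'I_4 -> {additive poly_sort -> poly_sort};
  psubst : ('I_4 -> poly_sort) -> {rmorphism poly_sort -> poly_sort};
  pcoef_eq0 : forall f, (forall k, pcoef k f = 0) -> f = 0;
  pcoef_1 : forall k, pcoef k 1 = (k == mnm0)%:R;
  pcoef_scalM : forall k a f, pcoef k (scal a * f) = a * pcoef k f;
  pcoef_varM : forall k i f, pcoef k (var i * f) =
    if k i == 0%N then 0 else pcoef (mnm_sub k (mnm1 i)) f;
  pderivM : forall i f g, pderiv i (f * g) = pderiv i f * g + f * pderiv i g;
  pderiv_scal : forall i a, pderiv i (scal a) = 0;
  pderiv_var : forall i j, pderiv i (var j) = (i == j)%:R;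
  pcoef_deriv : forall k i f,
    pcoef k (pderiv i f) = pcoef (mnm_add k (mnm1 i)) f *+ (k i).+1;
  psubst_scal : forall s a, psubst s (scal a) = scal a;
  psubst_var : forall s i, psubst s (var i) = s i;
  poly_bounded : forall f, exists n, below_degree pcoef n f;
  poly_degree_ind : forall K : nat -> poly_sort -> Prop,
    (forall n, K n 0) -> (forall n, K n.+1 1) ->
    (forall n f g, K n f -> K n g -> K n (f + g)) ->
    (forall n a f, K n f -> K n (scal a * f)) ->
    (forall n i f, K n f -> K n.+1 (var i * f)) ->
    forall n f, below_degree pcoef n f -> K n f
}.

Lemma mnm_ind (K : multinom 4 -> Prop) : K mnm0 ->
  (forall i k, K k -> K (mnm_add (mnm1 i) k)) -> forall k, K k.
Proof.
move=> K0 KS k; move: {2}(mdeg k) (erefl (mdeg k)) => n.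
elim: n k => [|n IHn] k kn.
  by move/eqP: kn; rewrite mdeg_eq0 => /eqP->.
have [i ki] : exists i, (0 < k i)%N.
  have [//|/forallNP k0] := pselect (exists i, (0 < k i)%N).
  move: kn; rewrite mdegE big1// => i _.
  by have /negP := k0 i; rewrite -eqn0Ngt => /eqP.
have kE : k = mnm_add (mnm1 i) (mnm_sub k (mnm1 i)).
  apply/mnmP => j; rewrite mnmDE mnmBE mnm1E; case: eqP => [<-|_] /=; lia.
rewrite kE; apply/KS/IHn.
by move: kn; rewrite {1}kE mdegD mdeg1 add1n => -[].
Qed.

Local Notation A := (mpoly 4 F).

Lemma mcoeff_varM k i (f : A) : mcoeff k (mpolyX F (mnm1 i) * f) =
  if k i == 0%N then 0 else mcoeff (mnm_sub k (mnm1 i)) f.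
Proof.
case: ifPn => [/eqP ki|ki].
  rewrite mcoeffM big1// => k' /eqP kE; rewrite mcoeffX.
  case: eqP => [E|_]; last by rewrite mul0r.
  by have := congr1 (fun k => k i) kE; rewrite /= -E mnmDE mnm1E eqxx ki.
have {1}-> : k = mnm_add (mnm1 i) (mnm_sub k (mnm1 i)).
  by apply/mnmP => j; rewrite mnmDE mnmBE mnm1E; case: eqP => [<-|_] /=; lia.
by rewrite mulrC mcoeffMX.
Qed.

Lemma mderiv_var i j : mderiv i (mpolyX F (mnm1 j)) = (i == j)%:R.
Proof.
rewrite mderivX mnm1E eq_sym; case: eqP => [->|_]; last by rewrite scale0r.
rewrite scale1r (_ : mnm_sub _ _ = mnm0) ?mpolyX0//.
by apply/mnmP => k; rewrite mnmBE subnn mnm0E.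
Qed.

Lemma mpoly_degree_ind (K : nat -> A -> Prop) :
  (forall n, K n 0) -> (forall n, K n.+1 1) ->
  (forall n f g, K n f -> K n g -> K n (f + g)) ->
  (forall n a f, K n f -> K n (mpolyC 4 a * f)) ->
  (forall n i f, K n f -> K n.+1 (mpolyX F (mnm1 i) * f)) ->
  forall n f, below_degree (@mcoeff 4 F) n f -> K n f.
Proof.
move=> K0 K1 KD Ks Kv n f fn.
have KX k l : (mdeg k < l)%N -> K l (mpolyX F k).
  elim/mnm_ind: k l => [|i k IHk] [|l]//; first by rewrite mpolyX0.
  by rewrite mdegD mdeg1 add1n ltnS mpolyXD => kl; apply/Kv/IHk.
rewrite [f]mpolyE; elim/big_ind: _ => //; first exact: KD.
move=> k _; rewrite -mul_mpolyC.
have [kn|nk] := ltnP (mdeg k) n; first exact/Ks/KX.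
by rewrite fn// mpolyC0 mul0r.
Qed.

Definition mpoly_polynomial_ring : polynomial_ring.
Proof.
apply: (@PolynomialRing (mpoly 4 F) (@mpolyC 4 F)
  (fun i => mpolyX F (mnm1 i)) (fun k => @mcoeff 4 F k) (fun i => @mderiv 4 F i)
  (fun s => @comp_mpoly 4 F 4 [tuple s i | i < 4])).
- by move=> f f0; apply/mpolyP => k; rewrite f0 mcoeff0.
- exact: mcoeff1.
- by move=> k a f; exact: mcoeffCM.
- exact: mcoeff_varM.
- exact: mderivM.
- exact: mderivC.
- exact: mderiv_var.
- by move=> k i f; exact: mcoeff_mderiv.
- by move=> s a; exact: comp_mpolyC.
- by move=> s i; rewrite [LHS](comp_mpolyXU i [tuple s j | j < 4]) -tnth_nth tnth_mktuple.
- move=> f; exists (mmeasure mdeg f) => k fk.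
  by apply: memN_msupp_eq0; exact: msize_mdeg_ge.
- exact: mpoly_degree_ind.
Qed.

End PolynomialRing.

Lemma forall_I4 (K : 'I_4 -> Prop) : K 0 -> K 1 -> K 2 -> K 3 -> forall i, K i.
Proof.
move=> K0 K1 K2 K3 i; have [->|->|->|->] // : [\/ i = 0, i = 1, i = 2 | i = 3].
case: i => [[|[|[|[|k]]]] lti]; last by [].
- by apply: Or41; exact: val_inj.
- by apply: Or42; exact: val_inj.
- by apply: Or43; exact: val_inj.
- by apply: Or44; exact: val_inj.
Qed.

Lemma sum_I4 (V : nmodType) (K : 'I_4 -> V) : \sum_i K i = K 0 + (K 1 + (K 2 + K 3)).
Proof.
rewrite !big_ord_recl big_ord0 addr0.
by congr (K _ + (K _ + (K _ + K _))); exact: val_inj.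
Qed.

Section SymbolCalculus.
Variables (F : fieldType) (A : polynomial_ring F).
Implicit Types (f g : A) (a b : F) (r : 'rV[F]_2) (u v : 'cV[F]_2) (i j : 'I_4).
Implicit Types (k : multinom 4) (n : nat).

Local Notation scal := (@scal F A).
Local Notation var := (@var F A).
Local Notation pderiv := (@pderiv F A).
Local Notation pcoef := (@pcoef F A).

Definition deg_lt n f := below_degree pcoef n f.

Lemma poly_ind (K : A -> Prop) : K 1 ->
  (forall f g, K f -> K g -> K (f + g)) -> (forall a f, K f -> K (scal a * f)) ->
  (forall i f, K f -> K (var i * f)) -> forall f, K f.
Proof.
move=> K1 KD Ks Kv f; have [n fn] := poly_bounded f.
elim/poly_degree_ind: fn => // _.
by rewrite -[0](mul0r 1) -(rmorph0 scal); exact: Ks.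
Qed.

Definition coordinate r : A := scal (r 0 0) * var 0 + scal (r 0 1) * var 1.
Definition momentum v : A := scal (v 0 0) * var 2 + scal (v 1 0) * var 3.

Lemma coordinateD r s : coordinate (r + s) = coordinate r + coordinate s.
Proof. by rewrite /coordinate !mxE !rmorphD /=; ring. Qed.

Lemma coordinateZ a r : coordinate (a *: r) = scal a * coordinate r.
Proof. by rewrite /coordinate !mxE !rmorphM /=; ring. Qed.

Lemma coordinate0 : coordinate 0 = 0.
Proof. by rewrite /coordinate !mxE rmorph0 !mul0r addr0. Qed.

Lemma coordinateN r : coordinate (- r) = - coordinate r.
Proof. by rewrite -scaleN1r coordinateZ rmorphN1 mulN1r. Qed.

Lemma momentumD u v : momentum (u + v) = momentum u + momentum v.
Proof. by rewrite /momentum !mxE !rmorphD /=; ring. Qed.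

Lemma momentumZ a v : momentum (a *: v) = scal a * momentum v.
Proof. by rewrite /momentum !mxE !rmorphM /=; ring. Qed.

Lemma momentumN v : momentum (- v) = - momentum v.
Proof. by rewrite -scaleN1r momentumZ rmorphN1 mulN1r. Qed.

Lemma deg_lt_eq0 f : deg_lt 0 f -> f = 0.
Proof. by move=> f0; apply: pcoef_eq0 => m; rewrite f0. Qed.

Lemma deg_lt_0 n : deg_lt n 0.
Proof. by move=> m _; rewrite raddf0. Qed.

Lemma deg_lt_1 n : deg_lt n.+1 1.
Proof. by move=> m mn; rewrite pcoef_1 -mdeg_eq0 -leqn0 leqNgt (leq_trans _ mn). Qed.

Lemma deg_ltD n f g : deg_lt n f -> deg_lt n g -> deg_lt n (f + g).
Proof. by move=> fn gn m mn; rewrite raddfD fn// gn// addr0. Qed.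

Lemma deg_lt_scal n a f : deg_lt n f -> deg_lt n (scal a * f).
Proof. by move=> fn m mn; rewrite pcoef_scalM fn// mulr0. Qed.

Lemma deg_ltN n f : deg_lt n f -> deg_lt n (- f).
Proof. by move=> fn m mn; rewrite raddfN fn// oppr0. Qed.

Lemma deg_ltB n f g : deg_lt n f -> deg_lt n g -> deg_lt n (f - g).
Proof. by move=> fn gn; apply/deg_ltD/deg_ltN. Qed.

Lemma deg_ltW n l f : (n <= l)%N -> deg_lt n f -> deg_lt l f.
Proof. by move=> nl fn m km; apply: fn; exact: leq_trans km. Qed.

Lemma deg_lt_sum n (I : Type) (s : seq I) (f_ : I -> A) :
  (forall t, deg_lt n (f_ t)) -> deg_lt n (\sum_(t <- s) f_ t).
Proof.
move=> fn; elim/big_ind: _ => //; [exact: deg_lt_0|exact: deg_ltD].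
Qed.

Lemma deg_lt_var n i f : deg_lt n f -> deg_lt n.+1 (var i * f).
Proof.
move=> fn m mn; rewrite pcoef_varM; case: eqP => // mi; apply: fn.
have mE : m = mnm_add (mnm1 i) (mnm_sub m (mnm1 i)).
  by apply/mnmP => j; rewrite mnmDE mnmBE mnm1E; case: eqP => [<-|_] /=; lia.
by move: mn; rewrite {1}mE mdegD mdeg1 add1n.
Qed.

Lemma deg_lt_deriv n i f : deg_lt n.+1 f -> deg_lt n (pderiv i f).
Proof.
by move=> fn m mn; rewrite pcoef_deriv fn ?mul0rn// mdegD mdeg1 addn1.
Qed.

Lemma deg_lt_coordinate n r f : deg_lt n f -> deg_lt n.+1 (coordinate r * f).
Proof.
move=> fn; rewrite mulrDl -!mulrA.
by apply: deg_ltD; apply/deg_lt_scal/deg_lt_var.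
Qed.

Lemma deg_lt_momentum n v f : deg_lt n f -> deg_lt n.+1 (momentum v * f).
Proof.
move=> fn; rewrite mulrDl -!mulrA.
by apply: deg_ltD; apply/deg_lt_scal/deg_lt_var.
Qed.

Section Substitution.
Variable rho : 'M[F]_2.

(** The pullback along the linear map [rho] of the plane on which [x], [y] are
    the coordinates; the momenta [xi], [eta] are left alone. *)
Definition subst_coord : {rmorphism A -> A} :=
  psubst (fun i => [:: coordinate (row 0 rho); coordinate (row 1 rho); var 2; var 3]`_i).

Lemma subst_scal a : subst_coord (scal a) = scal a.
Proof. exact: psubst_scal. Qed.

Lemma subst_coordinate r : subst_coord (coordinate r) = coordinate (r *m rho).
Proof.
rewrite /coordinate rmorphD !rmorphM /= !subst_scal.
rewrite /subst_coord !psubst_var /= -!coordinateZ -coordinateD.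
by rewrite -/(coordinate (r *m rho)); congr coordinate; apply: eq_rV2;
  rewrite !mulmx_I2 !mxE.
Qed.

Lemma subst_momentum v : subst_coord (momentum v) = momentum v.
Proof.
rewrite /momentum rmorphD !rmorphM /= !subst_scal.
by rewrite /subst_coord !psubst_var.
Qed.

End Substitution.

Lemma coordinate_neq0 r : r != 0 -> coordinate r != 0.
Proof.
have E i : pcoef (mnm1 i) (coordinate r) =
    r 0 0 * (0 == i)%:R + r 0 1 * (1 == i)%:R.
  have V j : pcoef (mnm1 i) (var j) = (j == i)%:R.
    rewrite -[var j]mulr1 pcoef_varM pcoef_1 mnm1E [in RHS]eq_sym.
    case: (eqVneq i j) => [->|//]; rewrite /= (_ : mnm_sub _ _ = mnm0) ?eqxx//.
    by apply/mnmP => k; rewrite mnmBE subnn mnm0E.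
  by rewrite /coordinate raddfD !pcoef_scalM !V.
apply: contra_neq => r0; apply: eq_rV2; rewrite [RHS]mxE.
  by have := E 0; rewrite r0 raddf0 mulr1 mulr0 addr0.
by have := E 1; rewrite r0 raddf0 mulr1 mulr0 add0r.
Qed.

Definition reflection_mx v : 'M[F]_2 := 1%:M - 2 *: (v *m v^T).

Lemma coordinate_reflection v r :
  coordinate r - coordinate (r *m reflection_mx v) =
  coordinate v^T * scal (2 * (r *m v) 0 0).
Proof.
rewrite mulrC -coordinateZ; apply/eqP; rewrite subr_eq -coordinateD; apply/eqP.
congr coordinate; rewrite mulmxBr mulmx1 -scalemxAr mulmxA.
by rewrite {2}[r *m v]mx11_scalar mul_scalar_mx scalerA addrCA subrr addr0.
Qed.

Lemma var_coordinate0 : var 0 = coordinate (row 0 1%:M).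
Proof. by rewrite /coordinate !mxE rmorph1 rmorph0 mul1r mul0r addr0. Qed.

Lemma var_coordinate1 : var 1 = coordinate (row 1 1%:M).
Proof. by rewrite /coordinate !mxE rmorph1 rmorph0 mul1r mul0r add0r. Qed.

Lemma var_momentum0 : var 2 = momentum (col 0 1%:M).
Proof. by rewrite /momentum !mxE rmorph1 rmorph0 mul1r mul0r addr0. Qed.

Lemma var_momentum1 : var 3 = momentum (col 1 1%:M).
Proof. by rewrite /momentum !mxE rmorph1 rmorph0 mul1r mul0r add0r. Qed.

Section DividedDifference.
Variable v : 'cV[F]_2.
Hypothesis v0 : v != 0.
Local Notation b := (coordinate v^T).
Local Notation s_v := (subst_coord (reflection_mx v)).

(** The polynomials [f] such that [b] divides [f - s_v f] form a subring, and
    the reflection [s_v] moves each letter by a multiple of [b]. *)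
Lemma divided_difference_exists f : exists g, f - s_v f = b * g.
Proof.
elim/poly_ind: f => [|f1 f2 [g1 E1] [g2 E2]|a f [g E]|i f [g E]].
- by exists 0; rewrite rmorph1 subrr mulr0.
- by exists (g1 + g2); rewrite rmorphD mulrDr -E1 -E2 /=; ring.
- by exists (scal a * g); rewrite rmorphM /= subst_scal mulrCA -E mulrBr.
have [h hE] : exists h, var i - s_v (var i) = b * h; last first.
  exists (h * f + s_v (var i) * g).
  by rewrite rmorphM /= mulrDr mulrA -hE mulrCA -E; ring.
elim/forall_I4: i.
- exists (scal (2 * (row 0 1%:M *m v) 0 0)).
  by rewrite -coordinate_reflection var_coordinate0 subst_coordinate.
- exists (scal (2 * (row 1 1%:M *m v) 0 0)).
  by rewrite -coordinate_reflection var_coordinate1 subst_coordinate.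
- by exists 0; rewrite var_momentum0 subst_momentum subrr mulr0.
- by exists 0; rewrite var_momentum1 subst_momentum subrr mulr0.
Qed.

Definition divdiff f : A := xget 0 [set g | f - s_v f = b * g].

Lemma divdiffP f : f - s_v f = b * divdiff f.
Proof. exact: (@xgetPex _ 0 [set g | f - s_v f = b * g] (divided_difference_exists f)). Qed.

Lemma divdiff_unique f g : f - s_v f = b * g -> divdiff f = g.
Proof.
rewrite divdiffP => /mulfI; apply; apply: coordinate_neq0.
by apply: contra_neq v0 => v0'; rewrite -[v]trmxK v0' trmx0.
Qed.

Lemma divdiffD : {morph divdiff : f g / f + g}.
Proof.
by move=> f g; apply: divdiff_unique; rewrite mulrDr -!divdiffP rmorphD opprD addrACA.
Qed.

Lemma divdiff_scal a f : divdiff (scal a * f) = scal a * divdiff f.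
Proof.
by apply: divdiff_unique; rewrite rmorphM /= subst_scal mulrCA -divdiffP mulrBr.
Qed.

Lemma divdiff_invariant f : s_v f = f -> divdiff f = 0.
Proof. by move=> fE; apply: divdiff_unique; rewrite fE subrr mulr0. Qed.

Lemma divdiff0 : divdiff 0 = 0.
Proof. by apply: divdiff_unique; rewrite rmorph0 subrr mulr0. Qed.

Lemma divdiff_invariantM g f : s_v g = g -> divdiff (g * f) = g * divdiff f.
Proof.
by move=> gE; apply: divdiff_unique; rewrite rmorphM /= gE mulrCA -divdiffP mulrBr.
Qed.

Lemma divdiff_coordinate r f : divdiff (coordinate r * f) =
  coordinate (r *m reflection_mx v) * divdiff f + scal (2 * (r *m v) 0 0) * f.
Proof.
apply: divdiff_unique; rewrite mulrDr mulrCA -divdiffP mulrA -coordinate_reflection.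
by rewrite rmorphM /= subst_coordinate; ring.
Qed.

Lemma deg_lt_divdiff n f : deg_lt n.+1 f -> deg_lt n (divdiff f).
Proof.
move=> fn; suff [] : deg_lt n (divdiff f) /\ deg_lt n.+1 f by [].
rewrite -[n in deg_lt n (divdiff f)]/(n.+1.-1).
elim/poly_degree_ind: n.+1 f / fn => [k|k|k f g [df fk] [dg gk]|k a f [df fk]|k i f [df fk]].
- by rewrite divdiff0; split; exact: deg_lt_0.
- rewrite divdiff_invariant ?rmorph1//; split; [exact: deg_lt_0|exact: deg_lt_1].
- by rewrite divdiffD; split; exact: deg_ltD.
- by rewrite divdiff_scal; split; exact: deg_lt_scal.
split; last exact: deg_lt_var.
case: k df fk => [|k] df fk /=.
  by rewrite (deg_lt_eq0 fk) mulr0 divdiff0; exact: deg_lt_0.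
have coord r : deg_lt k.+1 (divdiff (coordinate r * f)).
  rewrite divdiff_coordinate; apply: deg_ltD; last exact: deg_lt_scal.
  exact: deg_lt_coordinate.
have mom u : deg_lt k.+1 (divdiff (momentum u * f)).
  by rewrite divdiff_invariantM ?subst_momentum//; exact: deg_lt_momentum.
elim/forall_I4: i.
- by rewrite var_coordinate0; exact: coord.
- by rewrite var_coordinate1; exact: coord.
- by rewrite var_momentum0; exact: mom.
- by rewrite var_momentum1; exact: mom.
Qed.

End DividedDifference.

Lemma divdiffN v f : v != 0 -> divdiff (- v) f = - divdiff v f.
Proof.
move=> v0; apply: divdiff_unique; first by rewrite oppr_eq0.
have -> : reflection_mx (- v) = reflection_mx v.
  have vN : (- v)^T = - v^T by rewrite linearN.
  by rewrite /reflection_mx vN mulNmx mulmxN opprK.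
have -> : (- v)^T = -1 *: v^T by rewrite scaleN1r linearN.
by rewrite coordinateZ rmorphN1 mulN1r mulrNN divdiffP.
Qed.

Definition derive_along v f : A :=
  scal (v 0 0) * pderiv 0 f + scal (v 1 0) * pderiv 1 f.

Lemma derive_alongD v : {morph derive_along v : f g / f + g}.
Proof. by move=> f g; rewrite /derive_along !raddfD /=; ring. Qed.

Lemma derive_along_scal v a f : derive_along v (scal a * f) = scal a * derive_along v f.
Proof. by rewrite /derive_along !pderivM !pderiv_scal; ring. Qed.

Lemma derive_along_coordinate v r f : derive_along v (coordinate r * f) =
  scal ((r *m v) 0 0) * f + coordinate r * derive_along v f.
Proof.
rewrite /derive_along /coordinate !pderivM !raddfD !pderivM !pderiv_scal.
by rewrite !pderiv_var /= mulmx_I2 rmorphD !rmorphM /=; ring.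
Qed.

Lemma deg_lt_derive_along n v f : deg_lt n.+1 f -> deg_lt n (derive_along v f).
Proof. by move=> fn; apply: deg_ltD; apply/deg_lt_scal/deg_lt_deriv. Qed.

Lemma derive_along_linear a u v f :
  derive_along (a *: u + v) f = scal a * derive_along u f + derive_along v f.
Proof. by rewrite /derive_along !mxE !rmorphD !rmorphM /=; ring. Qed.

(** Polynomials in [xi], [eta], as they are seen by derivatives and divided
    differences in [x], [y]. *)
Definition momentum_only f :=
  [/\ pderiv 0 f = 0, pderiv 1 f = 0 & forall rho, subst_coord rho f = f].

Lemma momentum_only_scal a : momentum_only (scal a).
Proof. by split; rewrite ?pderiv_scal// => rho; exact: subst_scal. Qed.

Lemma momentum_onlyM v f : momentum_only f -> momentum_only (momentum v * f).
Proof.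
case=> f0 f1 fr; split=> [||rho]; last by rewrite rmorphM /= subst_momentum fr.
- by rewrite pderivM f0 /momentum raddfD !pderivM !pderiv_scal !pderiv_var /=; ring.
- by rewrite pderivM f1 /momentum raddfD !pderivM !pderiv_scal !pderiv_var /=; ring.
Qed.

Lemma momentum_only_derive v f : momentum_only f -> derive_along v f = 0.
Proof. by case=> f0 f1 _; rewrite /derive_along f0 f1 !mulr0 addr0. Qed.

Lemma momentum_only_divdiff v f : v != 0 -> momentum_only f -> divdiff v f = 0.
Proof. by move=> v0 [_ _ fr]; apply: divdiff_invariant. Qed.

End SymbolCalculus.

(** * The module of Dunkl operators *)

Section DunklModule.
Variables (R : realType) (m : nat) (c : 'M[R]_2 -> R[i]).
Local Notation C := R[i].
Local Notation G := (dihedral R m).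
Variable A : polynomial_ring C.
Local Notation scal := (@scal C A).
Local Notation coordinate := (@coordinate C A).
Local Notation momentum := (@momentum C A).
Local Notation M := (G -> A).
Local Notation cmx := (map_mx (real_complex R)).
Local Notation alpha j := (alpha_ R m j.+1).
Local Notation acov j := (acov_ R m j.+1).
Local Notation wt j := (c (srefl R m j.+1)).
Implicit Types (Phi Psi : M) (g h : G) (j : 'I_m) (r : 'rV[C]_2) (u v : 'cV[C]_2).
Implicit Types (a b : C).

Definition scaleM a Phi : M := fun h => scal a * Phi h.
Definition shiftM g Phi : M := fun h => Phi (mulG h g).
Lemma scaleME a Phi h : scaleM a Phi h = scal a * Phi h. Proof. by []. Qed.

Lemma shiftME g Phi h : shiftM g Phi h = Phi (mulG h g). Proof. by []. Qed.

Definition mul_dual r Phi : M := fun h => coordinate (r *m cmx (invmx (val h))) * Phi h.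
Definition rootpair j v : C := (cmx (acov j) *m v) 0 0.
Definition dualpair r j : C := (r *m cmx (alpha j)) 0 0.

Lemma reflection_mx_real (a : 'cV[R]_2) : a^T *m a = 1%:M ->
  reflection_mx (cmx a) = cmx (reflection_in a).
Proof.
move=> a1; rewrite reflection_unit// map_mxB map_mx1 map_mxZ map_mxM.
by rewrite -map_trmx rmorph_nat.
Qed.

Lemma root_neq0 g j : cmx (val g *m alpha j) != 0.
Proof.
apply/eqP => /(congr1 (fun v : 'cV_2 => (v^T *m v) 0 0)).
rewrite map_trmx -map_mxM trmx_mul mulmxA -(mulmxA _ (val g)^T) orthG mulmx1.
rewrite alpha_unit /= map_mx1 mulmx0 !mxE; apply/eqP; exact: oner_neq0.
Qed.

Definition root_divdiff h j (f : A) : A := divdiff (cmx (val h *m alpha j)) f.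

Lemma root_divdiffD h j : {morph root_divdiff h j : f g / f + g}.
Proof. exact: (divdiffD (root_neq0 h j)). Qed.

Lemma root_divdiff_scal h j a f : root_divdiff h j (scal a * f) = scal a * root_divdiff h j f.
Proof. exact: (divdiff_scal (root_neq0 h j)). Qed.

Lemma root_divdiff_momentum h j f : momentum_only f -> root_divdiff h j f = 0.
Proof. exact: (momentum_only_divdiff (root_neq0 h j)). Qed.

Lemma deg_lt_root_divdiff n h j f : deg_lt n.+1 f -> deg_lt n (root_divdiff h j f).
Proof. exact: (deg_lt_divdiff (root_neq0 h j)). Qed.

Lemma root_divdiff_coordinate h j r f :
  root_divdiff h j (coordinate (r *m cmx (invmx (val (mulG h (drefl R j))))) * f) =
  coordinate (r *m cmx (invmx (val h))) * root_divdiff h j f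
  - scal (2 * dualpair r j) * f.
Proof.
rewrite [LHS](divdiff_coordinate (root_neq0 h j)).
have sE : reflection_in (val h *m alpha j) = val h *m srefl R m j.+1 *m invmx (val h).
  by rewrite reflection_conj//; exact: orthG.
have -> : reflection_mx (cmx (val h *m alpha j)) = cmx (reflection_in (val h *m alpha j)).
  apply: reflection_mx_real.
  by rewrite trmx_mul mulmxA -(mulmxA _ (val h)^T) orthG mulmx1 alpha_unit.
rewrite -(mulmxA r) -map_mxM sE mulmxA mulVmx ?unitG// mul1mx.
congr (_ + _); rewrite -mulNr -rmorphN -mulrN; congr (scal (_ * _) * _).
rewrite /dualpair; have <- : (- (r *m cmx (alpha j))) 0 0 = - (r *m cmx (alpha j)) 0 0.
  by rewrite mxE.
congr (_ _ 0 0); rewrite -mulmxA -map_mxM -mulmxN -map_mxN; congr (_ *m cmx _).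
have -> : val h *m alpha j = - (val (mulG h (drefl R j)) *m alpha j).
  by rewrite /= -mulmxA reflection_vec ?alpha_unit// mulmxN opprK.
by rewrite mulmxN mulmxA mulVmx ?unitG// mul1mx.
Qed.

Lemma root_divdiff_perm g h (j k : 'I_m) (e : R) f : e ^+ 2 = 1 ->
  val g *m alpha j = e *: alpha k ->
  root_divdiff (mulG h g) j f = scal e%:C * root_divdiff h k f.
Proof.
move=> e1 gj; rewrite /root_divdiff /= -mulmxA gj -scalemxAr.
have [->|->] := sqr1_cases e1; first by rewrite scale1r rmorph1 mul1r.
rewrite scaleN1r map_mxN divdiffN; last exact: root_neq0.
by rewrite !rmorphN1 mulN1r.
Qed.

(** The Dunkl operators, with the term [momentum] added so that the vectors
    act freely. The value at [h] is expressed in axes turned by [h], which is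
    what makes right translation intertwine the operators. *)
Definition dunkl v Phi : M := fun h =>
  derive_along (cmx (val h) *m v) (Phi h) + momentum (cmx (val h) *m v) * Phi h
  + \sum_(j < m) scal (wt j * rootpair j v) *
      root_divdiff h j (Phi (mulG h (drefl R j))).

Lemma dunklD v Phi Psi : dunkl v (Phi + Psi) = dunkl v Phi + dunkl v Psi.
Proof.
apply/funext => h; rewrite /dunkl !fctE derive_alongD mulrDr.
rewrite (eq_bigr _ (fun j _ => congr1 _ (root_divdiffD h j _ _))).
rewrite (eq_bigr _ (fun j _ => mulrDr _ _ _)) big_split /=.
ring.
Qed.

Lemma dunklZ v a Phi : dunkl v (scaleM a Phi) = scaleM a (dunkl v Phi).
Proof.
apply/funext => h; rewrite /dunkl /scaleM derive_along_scal.
rewrite (eq_bigr (fun j : 'I_m => scal a * (scal (wt j * rootpair j v) *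
  root_divdiff h j (Phi (mulG h (drefl R j)))))) => [|j _].
  by rewrite -mulr_sumr; ring.
by rewrite root_divdiff_scal mulrCA.
Qed.

Lemma dunkl_linear a u v Phi :
  dunkl (a *: u + v) Phi = scaleM a (dunkl u Phi) + dunkl v Phi.
Proof.
apply/funext => h; rewrite !fctE /dunkl /scaleM mulmxDr -scalemxAr.
rewrite derive_along_linear momentumD momentumZ.
have E j : rootpair j (a *: u + v) = a * rootpair j u + rootpair j v.
  by rewrite /rootpair mulmxDr -scalemxAr !mxE.
rewrite (eq_bigr (fun j : 'I_m => scal a * (scal (wt j * rootpair j u) *
      root_divdiff h j (Phi (mulG h (drefl R j)))) +
      scal (wt j * rootpair j v) *
      root_divdiff h j (Phi (mulG h (drefl R j))))) => [|j _].
  by rewrite big_split /= -mulr_sumr; ring.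
by rewrite E mulrDr rmorphD mulrCA !rmorphM /=; ring.
Qed.

(** The defining commutator of a vector and a covector: Leibniz' rule for the
    derivative, and its twisted form for the divided differences. *)
Lemma dunkl_mul_dual v r Phi : dunkl v (mul_dual r Phi) =
  mul_dual r (dunkl v Phi) + scaleM ((r *m v) 0 0) Phi
  - \sum_(j < m) scaleM (2 * wt j * dualpair r j * rootpair j v) (shiftM (drefl R j) Phi).
Proof.
apply/funext => h; rewrite !fctE fct_sumE /dunkl /mul_dual /scaleM /shiftM.
rewrite derive_along_coordinate -mulmxA (mulmxA (cmx (invmx _))) -map_mxM.
rewrite mulVmx ?unitG// map_mx1 mul1mx.
rewrite (eq_bigr _ (fun j _ => congr1 _ (root_divdiff_coordinate h j _ _))).
rewrite (eq_bigr (fun j : 'I_m => coordinate (r *m cmx (invmx (val h))) *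
     (scal (wt j * rootpair j v) * root_divdiff h j (Phi (mulG h (drefl R j)))) -
   scal (2 * wt j * dualpair r j * rootpair j v) * Phi (mulG h (drefl R j)))) => [|j _].
  by rewrite sumrB -mulr_sumr; ring.
by rewrite !rmorphM /=; ring.
Qed.

Hypothesis c_inv : conj_invariant m c.

(** The divided differences are permuted by [g], and [c] is constant along the
    permutation. *)
Lemma dunkl_shift g v Phi : shiftM g (dunkl v Phi) = dunkl (cmx (val g) *m v) (shiftM g Phi).
Proof.
apply/funext => h; rewrite /shiftM /dunkl /= map_mxM -!mulmxA; congr (_ + _).
have [p [e e1 pE]] := root_permutation g.
rewrite [RHS](reindex_inj (@perm_inj _ p)); apply: eq_bigr => j _ /=.
rewrite (root_divdiff_perm h _ (e1 j) (pE j)) -!mulGA (drefl_conj (e1 j) (pE j)).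
rewrite (conj_invariant_root c_inv (e1 j) (pE j)) mulrA -rmorphM -mulrA.
congr (scal (_ * _) * _); rewrite /rootpair.
have -> : acov (p j) = e j *: (acov j *m (val g)^T).
  by rewrite !acovE -trmx_mul pE linearZ /= scalerA -expr2 e1 scale1r.
rewrite map_mxZ -scalemxAl [RHS]mxE mulrC; congr (_ * _).
by rewrite map_mxM mulmxA -(mulmxA _ (cmx (val g)^T)) -map_mxM orthG map_mx1 mulmx1.
Qed.

Lemma mul_dual_shift g r Phi :
  shiftM g (mul_dual r Phi) = mul_dual (r *m cmx (invmx (val g))) (shiftM g Phi).
Proof.
apply/funext => h; rewrite /shiftM /mul_dual -mulmxA -map_mxM.
suff -> : invmx (val (mulG h g)) = invmx (val g) *m invmx (val h) by [].
by rewrite !orthogonal_inv ?trmx_mul //; exact: orthG.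
Qed.

Lemma dunkl_sum v (I : Type) (s : seq I) (F : I -> M) :
  dunkl v (\sum_(k <- s) F k) = \sum_(k <- s) dunkl v (F k).
Proof.
apply: (big_morph (dunkl v) (dunklD v)).
have -> : (0 : M) = scaleM 0 0 by apply/funext => h; rewrite /scaleM rmorph0 mul0r.
by rewrite dunklZ; apply/funext => h; rewrite /scaleM rmorph0 !mul0r.
Qed.

(** The submodule spanned by products of coordinates and functions of the
    momenta, on which the commutation of Dunkl operators can be proved by
    induction on the number of coordinates. *)
Inductive generated : M -> Prop :=
| generated_momentum Phi : (forall h, momentum_only (Phi h)) -> generated Phi
| generatedD Phi Psi : generated Phi -> generated Psi -> generated (Phi + Psi)
| generated_mul r Phi : generated Phi -> generated (mul_dual r Phi).

Lemma generatedZ a Phi : generated Phi -> generated (scaleM a Phi).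
Proof.
elim=> {Phi} [Phi Phi0|Phi Psi _ gPhi _ gPsi|r Phi _ gPhi].
- apply: generated_momentum => h; have [f0 f1 fr] := Phi0 h.
  split=> [||rho]; rewrite /scaleM ?pderivM ?pderiv_scal ?f0 ?f1 ?mul0r ?mulr0 ?addr0//.
  by rewrite rmorphM /= subst_scal fr.
- suff -> : scaleM a (Phi + Psi) = scaleM a Phi + scaleM a Psi by exact: generatedD.
  by apply/funext => h; rewrite /scaleM !fctE mulrDr.
- suff -> : scaleM a (mul_dual r Phi) = mul_dual r (scaleM a Phi) by exact: generated_mul.
  by apply/funext => h; rewrite /scaleM /mul_dual mulrCA.
Qed.

Lemma generated_shift g Phi : generated Phi -> generated (shiftM g Phi).
Proof.
elim=> {Phi} [Phi Phi0|Phi Psi _ gPhi _ gPsi|r Phi _ gPhi].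
- by apply: generated_momentum => h; exact: Phi0.
- exact: generatedD.
- by rewrite mul_dual_shift; exact: generated_mul.
Qed.

Lemma generated0 : generated 0.
Proof.
apply: generated_momentum => h; rewrite -[0 h](rmorph0 scal).
exact: momentum_only_scal.
Qed.

Lemma generated_sum (I : Type) (s : seq I) (F : I -> M) :
  (forall k, generated (F k)) -> generated (\sum_(k <- s) F k).
Proof. by move=> gF; elim/big_ind: _ => //; [exact: generated0|exact: generatedD]. Qed.

Lemma dunkl_momentum v Phi : (forall h, momentum_only (Phi h)) ->
  dunkl v Phi = fun h => momentum (cmx (val h) *m v) * Phi h.
Proof.
move=> Phi0; apply/funext => h; rewrite /dunkl momentum_only_derive// add0r.
by rewrite big1 ?addr0// => j _; rewrite root_divdiff_momentum ?mulr0.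
Qed.

Lemma generated_dunkl v Phi : generated Phi -> generated (dunkl v Phi).
Proof.
elim=> {Phi} [Phi Phi0|Phi Psi _ gPhi _ gPsi|r Phi Phig gPhi].
- rewrite dunkl_momentum//; apply: generated_momentum => h.
  exact: momentum_onlyM.
- by rewrite dunklD; exact: generatedD.
- rewrite dunkl_mul_dual -sumrN; apply: generatedD; last first.
    apply: generated_sum => j; rewrite -mulN1r.
    rewrite (_ : _ * _ = scaleM (-1) (scaleM (2 * wt j * dualpair r j * rootpair j v) (shiftM (drefl R j) Phi))).
      by apply/generatedZ/generatedZ/generated_shift.
    by apply/funext => h; rewrite !fctE /scaleM rmorphN1.
  by apply: generatedD; [exact: generated_mul|exact: generatedZ].
Qed.

Lemma mul_dualD r Phi Psi : mul_dual r (Phi + Psi) = mul_dual r Phi + mul_dual r Psi.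
Proof. by apply/funext => h; rewrite /mul_dual !fctE mulrDr. Qed.

Lemma dunklN v Phi : dunkl v (- Phi) = - dunkl v Phi.
Proof.
have E Psi : - Psi = scaleM (-1) Psi.
  by apply/funext => h; rewrite /scaleM rmorphN1 mulN1r.
by rewrite !E dunklZ.
Qed.

(** A reflection moves [u] by a multiple of its root. *)
Lemma dunkl_drefl u j Phi : dunkl u (shiftM (drefl R j) Phi) =
  shiftM (drefl R j) (dunkl u Phi)
  - scaleM (2 * rootpair j u) (shiftM (drefl R j) (dunkl (cmx (alpha j)) Phi)).
Proof.
have uE : u = cmx (srefl R m j.+1) *m ((- (2 * rootpair j u)) *: cmx (alpha j) + u).
  have sa : cmx (srefl R m j.+1) *m cmx (alpha j) = - cmx (alpha j).
    by rewrite -map_mxM reflection_vec ?alpha_unit// map_mxN.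
  rewrite mulmxDr -scalemxAr sa scalerN scaleNr opprK.
  rewrite -reflection_mx_real ?alpha_unit// mulmxBl mul1mx -scalemxAl -mulmxA.
  rewrite map_trmx -acovE -scalerA addrCA -[LHS]addr0; congr (_ + _).
  rewrite /rootpair; set w := cmx (acov j) *m u.
  by rewrite {2}[w]mx11_scalar mul_mx_scalar subrr.
rewrite {1}uE -(dunkl_shift (drefl R j)) dunkl_linear.
apply/funext => h; rewrite /shiftM !fctE /scaleM rmorphN mulNr addrC //.
Qed.

(** Apart from its first term this expression is symmetric in [u] and [v], so
    that the commutator of two Dunkl operators commutes with multiplication by
    coordinates. *)
Lemma dunkl_dunkl_mul u v r Phi h : dunkl u (dunkl v (mul_dual r Phi)) h =
  mul_dual r (dunkl u (dunkl v Phi)) h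
  + (scal ((r *m u) 0 0) * dunkl v Phi h + scal ((r *m v) 0 0) * dunkl u Phi h)
  - \sum_(j < m) scal (2 * wt j * dualpair r j) *
     (scal (rootpair j u) * dunkl v Phi (mulG h (drefl R j))
      + scal (rootpair j v) * dunkl u Phi (mulG h (drefl R j))
      - scal (2 * rootpair j u * rootpair j v)
        * dunkl (cmx (alpha j)) Phi (mulG h (drefl R j))).
Proof.
rewrite dunkl_mul_dual (dunklD u (_ + _)) (dunklD u (mul_dual _ _)) dunklN dunkl_sum.
rewrite dunklZ dunkl_mul_dual !fctE !fct_sumE !scaleME.
set s1 := \sum_(j < m) _; set s2 := \sum_(j < m) _; set s3 := \sum_(j < m) _.
suff -> : s3 = s1 + s2 by ring.
rewrite -big_split; apply: eq_bigr => j _ /=.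
by rewrite dunklZ dunkl_drefl scaleME !fctE !scaleME !shiftME !rmorphM /=; ring.
Qed.

Lemma dunkl_comm u v Phi : generated Phi ->
  dunkl u (dunkl v Phi) = dunkl v (dunkl u Phi).
Proof.
elim=> {Phi} [Phi Phi0|Phi Psi _ gPhi _ gPsi|r Phi _ gPhi].
- rewrite !(dunkl_momentum _ Phi0) !dunkl_momentum => [||h].
  + by apply/funext => h; rewrite mulrCA.
  + by move=> h; exact: momentum_onlyM.
  + exact: momentum_onlyM.
- by rewrite !(dunklD _ Phi Psi) !(dunklD _ (dunkl _ Phi)) gPhi gPsi.
apply/funext => h; rewrite !dunkl_dunkl_mul gPhi; congr (_ + _ - _).
  exact: addrC.
apply: eq_bigr => j _; rewrite !rmorphM /=; ring.
Qed.

Local Notation expr := (expr R m).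

Fixpoint interp (p : expr) (Phi : M) : M :=
  match p with
  | Evec w => mul_dual w.2 Phi + dunkl w.1 Phi
  | Egrp g => shiftM g Phi
  | Eone => Phi
  | Ezero => 0
  | Eadd p q => interp p Phi + interp q Phi
  | Emul p q => interp p (interp q Phi)
  | Escale a p => scaleM a (interp p Phi)
  end.

Lemma interp_mul p q Phi : interp (Emul p q) Phi = interp p (interp q Phi).
Proof. by []. Qed.

Lemma interp_add p q Phi : interp (Eadd p q) Phi = interp p Phi + interp q Phi.
Proof. by []. Qed.

Lemma interp_scale a p Phi : interp (Escale a p) Phi = scaleM a (interp p Phi).
Proof. by []. Qed.

Lemma generated_interp p Phi : generated Phi -> generated (interp p Phi).
Proof.
elim: p Phi => //= [w|g||p IHp q IHq|p IHp q IHq|a p IHp] Phi gPhi.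
- by apply: generatedD; [exact: generated_mul|exact: generated_dunkl].
- exact: generated_shift.
- exact: generated0.
- by apply: generatedD; [exact: IHp|exact: IHq].
- by apply/IHp/IHq.
- exact/generatedZ/IHp.
Qed.

Lemma interpD p Phi Psi : interp p (Phi + Psi) = interp p Phi + interp p Psi.
Proof.
elim: p Phi Psi => //= [w||p IHp q IHq|p IHp q IHq|a p IHp] Phi Psi.
- by rewrite dunklD mul_dualD addrACA.
- by rewrite addr0.
- by rewrite IHp IHq addrACA.
- by rewrite IHq IHp.
- by rewrite IHp; apply/funext => h; rewrite scaleME !fctE mulrDr.
Qed.

Lemma scaleMA a b Phi : scaleM a (scaleM b Phi) = scaleM (a * b) Phi.
Proof. by apply/funext => h; rewrite !scaleME rmorphM mulrA. Qed.

Lemma scaleMDr a Phi Psi : scaleM a (Phi + Psi) = scaleM a Phi + scaleM a Psi.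
Proof. by apply/funext => h; rewrite !fctE !scaleME mulrDr. Qed.

Lemma scaleMDl a b Phi : scaleM (a + b) Phi = scaleM a Phi + scaleM b Phi.
Proof. by apply/funext => h; rewrite !fctE !scaleME rmorphD mulrDl. Qed.

Lemma scaleM1 Phi : scaleM 1 Phi = Phi.
Proof. by apply/funext => h; rewrite scaleME rmorph1 mul1r. Qed.

Lemma scaleMN1 Phi : scaleM (-1) Phi = - Phi.
Proof. by apply/funext => h; rewrite scaleME rmorphN1 mulN1r. Qed.

Lemma interpZ p a Phi : interp p (scaleM a Phi) = scaleM a (interp p Phi).
Proof.
elim: p Phi => //= [w||p IHp q IHq|p IHp q IHq|b p IHp] Phi.
- rewrite scaleMDr dunklZ; congr (_ + _).
  by apply/funext => h; rewrite /mul_dual !scaleME mulrCA.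
- by apply/funext => h; rewrite scaleME mulr0.
- by rewrite IHp IHq scaleMDr.
- by rewrite IHq IHp.
- by rewrite IHp !scaleMA mulrC.
Qed.

Lemma interp_vec a (v w : phase R) Phi :
  interp (Evec m (a *: v + w)) Phi =
  scaleM a (interp (Evec m v) Phi) + interp (Evec m w) Phi.
Proof.
rewrite /= dunkl_linear scaleMDr addrACA; congr (_ + _).
apply/funext => h; rewrite !fctE scaleME /mul_dual mulmxDl -scalemxAl.
by rewrite coordinateD coordinateZ mulrDl mulrA.
Qed.

Lemma dunkl0 Phi : dunkl 0 Phi = 0.
Proof.
rewrite -[X in dunkl X _](subrr (0 : 'cV_2)) addrC -scaleN1r dunkl_linear scaleMN1.
by rewrite addNr.
Qed.

Lemma interp_inE (v : 'cV[R]_2) Phi : interp (Evec m (Defs.inE v)) Phi = dunkl (cmx v) Phi.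
Proof.
rewrite /= [X in X + _](_ : _ = 0) ?add0r//.
by apply/funext => h; rewrite /mul_dual mul0mx coordinate0 mul0r.
Qed.

Lemma interp_inEdual (r : 'rV[R]_2) Phi :
  interp (Evec m (inEdual r)) Phi = mul_dual (cmx r) Phi.
Proof. by rewrite /= dunkl0 addr0. Qed.

Lemma pairingE (r : 'rV[R]_2) (v : 'cV[R]_2) :
  (pairing r v)%:C = (cmx r *m cmx v) 0 0.
Proof. by rewrite -map_mxM mxE. Qed.

(** The action respects the relations of the algebra: those between vectors by
    [dunkl_comm], those between a vector and a covector by [dunkl_mul_dual], and
    those with the group by [dunkl_shift] and [mul_dual_shift]. *)
Lemma interp_cong p q : cong c p q ->
  forall Phi, generated Phi -> interp p Phi = interp q Phi.
Proof.
elim=> {p q}.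
- by [].
- by move=> p q _ IH Phi gPhi; rewrite IH.
- by move=> p q r _ IHpq _ IHqr Phi gPhi; rewrite IHpq ?IHqr.
- by move=> p p' q q' _ IHp _ IHq Phi gPhi /=; rewrite IHp ?IHq.
- move=> p p' q q' _ IHp _ IHq Phi gPhi /=; rewrite IHq// IHp//.
  exact: generated_interp.
- by move=> a p p' _ IHp Phi gPhi /=; rewrite IHp.
- by move=> p q r Phi _ /=; rewrite addrA.
- by move=> p q Phi _ /=; rewrite addrC.
- by move=> p Phi _ /=; rewrite add0r.
- by move=> p Phi _ /=; rewrite scaleMN1 addNr.
- by move=> a b p Phi _ /=; rewrite scaleMA.
- by move=> p Phi _ /=; rewrite scaleM1.
- by move=> a p q Phi _ /=; rewrite scaleMDr.
- by move=> a b p Phi _ /=; rewrite scaleMDl.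
- by [].
- by [].
- by [].
- by [].
- by move=> p q r Phi _ /=; rewrite interpD.
- by [].
- by move=> a p q Phi _ /=; rewrite interpZ.
- by move=> a v w Phi _; rewrite interp_vec.
- move=> g g1 Phi _ /=; apply/funext => h; rewrite shiftME; congr Phi.
  by apply: val_inj; rewrite /= g1 mulmx1.
- move=> g h k kE Phi _ /=; apply/funext => l; rewrite !shiftME; congr Phi.
  by apply: val_inj; rewrite /= kE mulmxA.
- move=> g v Phi _ /=.
  rewrite -[LHS]/(shiftM g (mul_dual v.2 Phi) + shiftM g (dunkl v.1 Phi)).
  by rewrite dunkl_shift mul_dual_shift.
- move=> u v Phi gPhi; rewrite !interp_mul.
  by rewrite !interp_inE dunkl_comm.
- move=> x' y' Phi _; rewrite !interp_mul.
  rewrite !interp_inEdual.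
  by apply/funext => h; rewrite /mul_dual mulrCA.
move=> v x' Phi _.
rewrite !interp_add !interp_scale !interp_mul.
rewrite !interp_inE !interp_inEdual !scaleMN1 dunkl_mul_dual.
rewrite addrC addrA addrA addNr add0r pairingE; congr (_ - _).
rewrite (big_morph (fun p => interp p Phi) (id1 := 0) (op1 := +%R))//.
apply/funext => h; rewrite scaleME !fct_sumE mulr_sumr; apply: eq_bigr => j _.
by rewrite /= !scaleME !shiftME mulrA -rmorphM !pairingE !mulrA.
Qed.

End DunklModule.

(** * Relations of the rational Cherednik algebra *)

Section CherednikAlgebra.
Variables (R : realType) (m : nat) (c : 'M[R]_2 -> R[i]).
Local Notation C := R[i].
Local Notation G := (dihedral R m).
Local Notation H := (cherednik m c).
Local Notation grpH := (@grpH R m c).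
Local Notation vecH := (@vecH R m c).
Local Notation cls := (@cls R m c).
Local Notation cmx := (map_mx (real_complex R)).
Local Notation alpha j := (alpha_ R m j.+1).
Local Notation acov j := (acov_ R m j.+1).
Local Notation wt j := (c (srefl R m j.+1)).
Implicit Types (a b : C) (g : G) (h k : H) (v w : phase R).

Lemma clsDE p q : cls (Eadd p q) = cls p + cls q. Proof. by rewrite -clsD. Qed.
Lemma clsME p q : cls (Emul p q) = cls p * cls q. Proof. by rewrite -clsM. Qed.
Lemma clsZE a p : cls (Escale a p) = a *: cls p. Proof. by rewrite -clsZ. Qed.
Lemma clsNE p : cls (Eopp p) = - cls p. Proof. by rewrite clsZE scaleN1r. Qed.
Lemma cls1E : cls (Eone R m) = 1. Proof. by []. Qed.
Lemma cls0E : cls (Ezero R m) = 0. Proof. by []. Qed.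

Lemma cls_sum (I : Type) (s : seq I) (F : I -> expr R m) :
  cls (\big[@Eadd R m/@Ezero R m]_(i <- s) F i) = \sum_(i <- s) cls (F i).
Proof. exact: (big_morph cls clsDE cls0E). Qed.

Lemma scaleMl a h k : (a *: h) * k = a *: (h * k).
Proof. by rewrite cherednik_scalerAl. Qed.

Lemma scaleMr a h k : h * (a *: k) = a *: (h * k).
Proof. by rewrite cherednik_scalerAr. Qed.

Lemma vecH_linear a v w : vecH (a *: v + w) = a *: vecH v + vecH w.
Proof. by rewrite -clsZE -clsDE; apply/clsP/cong_vec. Qed.

Lemma vecH0 : vecH 0 = 0.
Proof.
have := vecH_linear (-1) 0 0; rewrite scaler0 addr0 scaleN1r => ->.
by rewrite addNr.
Qed.

Lemma vecHD v w : vecH (v + w) = vecH v + vecH w.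
Proof. by rewrite -[v]scale1r vecH_linear !scale1r. Qed.

Lemma vecHZ a v : vecH (a *: v) = a *: vecH v.
Proof. by rewrite -[a *: v]addr0 vecH_linear vecH0 addr0. Qed.

Lemma grpH1 : grpH (oneG R m) = 1.
Proof. by rewrite -cls1E; apply/clsP/cong_grp1. Qed.

Lemma grpHM g g' : grpH g * grpH g' = grpH (mulG g g').
Proof. by rewrite -clsME; apply/clsP/cong_grpM. Qed.

Lemma grpH_vecH g v : grpH g * vecH v = vecH (act (val g) v) * grpH g.
Proof. by rewrite -!clsME; apply/clsP/cong_act. Qed.

Lemma vecH_grpH g v : vecH v * grpH g = grpH g * vecH (act (val (invG g)) v).
Proof.
rewrite grpH_vecH; congr (vecH _ * _); case: v => v1 v2.
rewrite /act /= mulmxA -map_mxM mulmxV ?unitG// map_mx1 mul1mx.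
by rewrite -mulmxA -map_mxM invmxK mulmxV ?unitG// map_mx1 mulmx1.
Qed.

Local Notation vecE u := (vecH (Defs.inE u)).
Local Notation vecD r := (vecH (inEdual r)).
Implicit Types (u : 'cV[R]_2) (r : 'rV[R]_2).

Lemma vecE_comm u u' : vecE u * vecE u' = vecE u' * vecE u.
Proof. by rewrite -!clsME; apply/clsP/cong_EE. Qed.

Lemma vecD_comm r r' : vecD r * vecD r' = vecD r' * vecD r.
Proof. by rewrite -!clsME; apply/clsP/cong_dualdual. Qed.

Definition reflection_part r u : H := 2 *: \sum_(j < m)
  (wt j * (pairing r (alpha j))%:C * (pairing (acov j) u)%:C) *: grpH (drefl R j).

Lemma vecE_vecD u r : vecE u * vecD r =
  vecD r * vecE u + (pairing r u)%:C *: (1 : H) - reflection_part r u.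
Proof.
have /clsP := @cong_Edual R m c u r.
rewrite clsDE clsNE !clsME clsDE clsZE cls1E clsNE clsZE cls_sum => E.
rewrite -[LHS](subrK (vecD r * vecE u)) [X in X + _ = _]E.
rewrite addrC addrA; congr (_ - (2 *: _)).
by apply: eq_bigr => j _; rewrite clsZE.
Qed.

Definition letterV (i : 'I_4) : phase R :=
  [:: inEdual (xE R); inEdual (yE R); Defs.inE (xiE R); Defs.inE (etaE R)]`_i.
Definition letter i : H := vecH (letterV i).

Lemma vecH_letters v : vecH v = v.2 0 0 *: letter 0 + v.2 0 1 *: letter 1
  + v.1 0 0 *: letter 2 + v.1 1 0 *: letter 3.
Proof.
rewrite -!vecHZ -!vecHD; congr vecH; case: v => v1 v2 /=.
congr (_, _).
  rewrite -[RHS]/(v2 0 0 *: 0 + v2 0 1 *: 0 + v1 0 0 *: cmx (xiE R)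
    + v1 1 0 *: cmx (etaE R)) !scaler0 !add0r.
  by apply: eq_cV2; rewrite /xiE /etaE ord_max_I2 !mxE /=; ring.
rewrite -[RHS]/(v2 0 0 *: cmx (xE R) + v2 0 1 *: cmx (yE R) + v1 0 0 *: 0
    + v1 1 0 *: 0) !scaler0 !addr0.
by apply: eq_rV2; rewrite /xE /yE ord_max_I2 !mxE /=; ring.
Qed.

Lemma linear_span_closed (S : set H) : Defs.linear_closed (linear_span S).
Proof.
split=> [T [[T0 _] _] //|a h k Hh Hk T HT]; have [[_ TD] _] := HT.
by apply: TD; [exact: Hh|exact: Hk].
Qed.

End CherednikAlgebra.

(** * Normal forms and symbols *)

Section Symbols.
Variables (R : realType) (m : nat) (c : 'M[R]_2 -> R[i]).
Hypothesis c_inv : conj_invariant m c.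
Local Notation C := R[i].
Local Notation G := (dihedral R m).
Local Notation H := (cherednik m c).
Variable A : polynomial_ring C.
Local Notation M := (G -> A).
Local Notation grpH := (@grpH R m c).
Local Notation vecH := (@vecH R m c).
Local Notation cls := (@cls R m c).
Local Notation letter := (@letter R m c).
Local Notation linear_closed := (@Defs.linear_closed R m c).
Local Notation cmx := (map_mx (real_complex R)).
Local Notation scal := (@scal C A).
Local Notation var := (@var C A).
Local Notation pcoef := (@pcoef C A).
Local Notation pderiv := (@pderiv C A).
Implicit Types (a b : C) (g : G) (h k : H) (v w : phase R) (f : A).

Definition vacuum : M := fun g => (g == oneG R m)%:R.

Lemma vacuum_generated : generated vacuum.
Proof.
apply: generated_momentum => g; rewrite /vacuum -(rmorph_nat scal).
exact: momentum_only_scal.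
Qed.

(** The value at [invG g] is the component of [h] on [g] when [h] is written
    with the group on the left, followed by covectors and then by vectors: the
    module is modelled on the algebra acting on itself by left multiplication,
    and the vacuum on the unit. *)
Definition normal_form h : M := interp c (repr h) vacuum.

Lemma normal_form_cls p : normal_form (cls p) = interp c p vacuum.
Proof. exact: (interp_cong c_inv (repr_cls c p) vacuum_generated). Qed.

Lemma normal_formD h k : normal_form (h + k) = normal_form h + normal_form k.
Proof.
elim/cls_ind: h => p; elim/cls_ind: k => q.
by rewrite -clsDE !normal_form_cls.
Qed.

Lemma normal_formZ a h : normal_form (a *: h) = scaleM a (normal_form h).
Proof. by elim/cls_ind: h => p; rewrite -clsZE !normal_form_cls. Qed.

Lemma normal_form1 : normal_form 1 = vacuum.
Proof. by rewrite -cls1E normal_form_cls. Qed.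

Lemma normal_form0 : normal_form 0 = 0.
Proof. by rewrite -cls0E normal_form_cls. Qed.

Lemma normal_form_grpM g h : normal_form (grpH g * h) = shiftM g (normal_form h).
Proof. by elim/cls_ind: h => p; rewrite -clsME !normal_form_cls. Qed.

Lemma normal_form_vecM v h : normal_form (vecH v * h) =
  mul_dual v.2 (normal_form h) + dunkl c v.1 (normal_form h).
Proof. by elim/cls_ind: h => p; rewrite -clsME !normal_form_cls. Qed.

Lemma normal_formN h : normal_form (- h) = - normal_form h.
Proof. by rewrite -scaleN1r normal_formZ scaleMN1. Qed.

Lemma normal_formB h k : normal_form (h - k) = normal_form h - normal_form k.
Proof. by rewrite normal_formD normal_formN. Qed.

(** [h] has degree at most [n], and its part of degree [n], which is that of
    [f], does not involve the group. *)
Definition has_symbol n h f :=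
  deg_lt n.+1 f /\ forall g, deg_lt n (normal_form h g - vacuum g * f).

Definition linear_form v : A := coordinate A v.2 + momentum A v.1.

Lemma vacuumE g f : vacuum g * f = if g == oneG R m then f else 0.
Proof. by rewrite /vacuum; case: eqP; rewrite ?mul1r ?mul0r. Qed.

Lemma has_symbolD n h k f f' :
  has_symbol n h f -> has_symbol n k f' -> has_symbol n (h + k) (f + f').
Proof.
move=> [fn hf] [fn' kf']; split=> [|g]; first exact: deg_ltD.
by rewrite normal_formD fctE mulrDr opprD addrACA; exact: deg_ltD.
Qed.

Lemma has_symbolZ n a h f : has_symbol n h f -> has_symbol n (a *: h) (scal a * f).
Proof.
move=> [fn hf]; split=> [|g]; first exact: deg_lt_scal.
by rewrite normal_formZ scaleME mulrCA -mulrBr; exact: deg_lt_scal.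
Qed.

Lemma has_symbol1 : has_symbol 0 1 1.
Proof.
split=> [|g]; first exact: deg_lt_1.
by rewrite normal_form1 mulr1 subrr; exact: deg_lt_0.
Qed.

Lemma has_symbol0 n : has_symbol n 0 0.
Proof.
split=> [|g]; first exact: deg_lt_0.
by rewrite normal_form0 mulr0 subr0; exact: deg_lt_0.
Qed.

Lemma has_symbolN n h f : has_symbol n h f -> has_symbol n (- h) (- f).
Proof. by move=> /(has_symbolZ (-1)); rewrite scaleN1r rmorphN1 mulN1r. Qed.

Lemma has_symbolW n h f : has_symbol n h f -> has_symbol n.+1 h 0.
Proof.
move=> [fn hf]; split=> [|g]; first exact: deg_lt_0.
rewrite mulr0 subr0 -(subrK (vacuum g * f) (normal_form h g)).
apply: deg_ltD; first exact: deg_ltW (hf g).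
by rewrite vacuumE; case: eqP => // _; exact: deg_lt_0.
Qed.

Lemma deg_lt_normal_form n h f g : has_symbol n h f -> deg_lt n.+1 (normal_form h g).
Proof. by move=> /has_symbolW[_ /(_ g)]; rewrite mulr0 subr0. Qed.

(** Multiplication by a vector or a covector acts on leading terms by
    multiplication: derivatives and divided differences lower the degree, and
    the twist by [g] disappears where the vacuum is not zero. *)
Lemma has_symbol_vec n v h f :
  has_symbol n h f -> has_symbol n.+1 (vecH v * h) (linear_form v * f).
Proof.
move=> hf; have [fn {}hf'] := hf.
split=> [|g].
  by rewrite mulrDl; apply: deg_ltD; [exact: deg_lt_coordinate|exact: deg_lt_momentum].
have hn g' := deg_lt_normal_form g' hf.
rewrite normal_form_vecM !fctE /mul_dual /dunkl.
set s := \sum_(j < m) _; set d := derive_along _ _.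
set x := coordinate _ _; set p := momentum _ _.
have -> : x * normal_form h g + (d + p * normal_form h g + s) -
    vacuum g * (linear_form v * f) =
    (x * (normal_form h g - vacuum g * f) + p * (normal_form h g - vacuum g * f))
     + (d + s) + (vacuum g * ((x + p - linear_form v) * f)) by ring.
apply: deg_ltD; last first.
  rewrite vacuumE; case: eqP => [g1|_]; last exact: deg_lt_0.
  rewrite /x /p g1 /= invmx1 map_mx1 mulmx1 mul1mx subrr mul0r; exact: deg_lt_0.
apply: deg_ltD.
  by apply: deg_ltD; [exact: deg_lt_coordinate|exact: deg_lt_momentum].
apply: (@deg_ltW _ _ n) => //; apply: deg_ltD; first exact: deg_lt_derive_along.
by apply: deg_lt_sum => j; apply: deg_lt_scal; exact: deg_lt_root_divdiff.
Qed.

Lemma linear_form_letter i : linear_form (letterV R i) = var i.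
Proof.
rewrite /linear_form /coordinate /momentum.
elim/forall_I4: i; rewrite /letterV /= /xiE /etaE /xE /yE ?ord_max_I2 !mxE /=.
- by rewrite rmorph1 rmorph0 mul1r !mul0r !addr0.
- by rewrite rmorph1 rmorph0 mul1r !mul0r !addr0 add0r.
- by rewrite rmorph1 rmorph0 mul1r !mul0r !add0r addr0.
- by rewrite rmorph1 rmorph0 mul1r !mul0r !add0r.
Qed.

Implicit Types W : seq 'I_4.

Definition wordH W : H := \prod_(i <- W) letter i.
Definition wordA W : A := \prod_(i <- W) var i.

Lemma wordH_nil : wordH [::] = 1. Proof. exact: big_nil. Qed.

Lemma wordH_cons i W : wordH (i :: W) = letter i * wordH W.
Proof. exact: big_cons. Qed.

Lemma has_symbol_word W : has_symbol (size W) (wordH W) (wordA W).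
Proof.
elim: W => [|i W IHW]; first by rewrite /wordH /wordA !big_nil; exact: has_symbol1.
by rewrite /wordH /wordA !big_cons -linear_form_letter; exact: has_symbol_vec.
Qed.

Definition exponents W : multinom 4 := foldr (fun i => mnm_add (mnm1 i)) mnm0 W.

Lemma exponentsE W i : exponents W i = count_mem i W.
Proof. by elim: W => [|j W IHW] /=; rewrite ?mnm0E// mnmDE mnm1E IHW eq_sym. Qed.

Lemma mdeg_exponents W : mdeg (exponents W) = size W.
Proof. by elim: W => [|j W IHW] /=; rewrite ?mdeg0// mdegD mdeg1 IHW. Qed.

Lemma pcoef_word W (e : multinom 4) : pcoef e (wordA W) = (e == exponents W)%:R.
Proof.
elim: W e => [|i W IHW] e; first by rewrite /wordA big_nil pcoef_1.
rewrite /wordA big_cons pcoef_varM; case: ifPn => [/eqP ei|ei].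
  by case: eqP => // eE; move: ei; rewrite eE /= mnmDE mnm1E eqxx.
rewrite IHW /=; congr (nat_of_bool _)%:R; apply/eqP/eqP => [<-|->].
  by apply/mnmP => j; rewrite mnmDE mnmBE mnm1E; case: eqP => [<-|_] /=; lia.
by apply/mnmP => j; rewrite mnmBE mnmDE addKn.
Qed.

(** * The filtration by degree and the Poincare-Birkhoff-Witt theorem *)

(** Elements of degree less than [n], not at most [n]: [filtration 1] is the
    group algebra and [filtration 0] is zero. *)
Definition filtration n : set H := linear_span
  [set h | exists g W, (size W < n)%N /\ h = grpH g * wordH W].

Lemma filtration_closed n : linear_closed (filtration n).
Proof. exact: linear_span_closed. Qed.

Lemma filtration_ind n (S : set H) : linear_closed S ->
  (forall g W, (size W < n)%N -> S (grpH g * wordH W)) ->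
  forall h, filtration n h -> S h.
Proof.
move=> Scl SW h; apply; split=> // _ [g [W [Wn ->]]]; exact: SW.
Qed.

Lemma filtration_word n g W : (size W < n)%N -> filtration n (grpH g * wordH W).
Proof. by move=> Wn S [_]; apply; exists g, W. Qed.

Lemma filtration0 n : filtration n 0.
Proof. by have [] := filtration_closed n. Qed.

Lemma filtrationP n a h k : filtration n h -> filtration n k -> filtration n (a *: h + k).
Proof. by have [_] := filtration_closed n; apply. Qed.

Lemma filtrationD n h k : filtration n h -> filtration n k -> filtration n (h + k).
Proof. by rewrite -{2}[h]scale1r; exact: filtrationP. Qed.

Lemma filtrationZ n a h : filtration n h -> filtration n (a *: h).
Proof. by move=> hn; rewrite -[_ *: _]addr0; apply: filtrationP => //; exact: filtration0. Qed.

Lemma filtrationB n h k : filtration n h -> filtration n k -> filtration n (h - k).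
Proof. by move=> hn kn; rewrite -scaleN1r addrC; exact: filtrationP. Qed.

Lemma filtration_sum n (I : Type) (s : seq I) (P : pred I) (F : I -> H) :
  (forall i, filtration n (F i)) -> filtration n (\sum_(i <- s | P i) F i).
Proof. by move=> Fn; elim/big_ind: _ => //; [exact: filtration0|exact: filtrationD]. Qed.

Lemma filtrationW n l h : (n <= l)%N -> filtration n h -> filtration l h.
Proof.
move=> nl; apply: filtration_ind; first exact: filtration_closed.
by move=> g W Wn; apply: filtration_word; exact: leq_trans nl.
Qed.

Lemma filtration_eq0 h : filtration 0 h -> h = 0.
Proof.
apply: (filtration_ind (S := [set 0])) => //.
by split=> [//|a u v -> ->]; rewrite /= scaler0 addr0.
Qed.

Lemma filtration_grp g : filtration 1 (grpH g).
Proof.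
by rewrite -[grpH g]mulr1 -wordH_nil; exact: filtration_word.
Qed.

Lemma filtration_grpM n g h : filtration n h -> filtration n (grpH g * h).
Proof.
apply: (filtration_ind (S := fun h => filtration n (grpH g * h))).
  split=> [|a u v Hu Hv]; first by rewrite mulr0; exact: filtration0.
  by rewrite mulrDr scaleMr; exact: filtrationP.
by move=> g' W Wn; rewrite mulrA grpHM; exact: filtration_word.
Qed.

Lemma filtration_vecM n v h : filtration n h -> filtration n.+1 (vecH v * h).
Proof.
apply: (filtration_ind (S := fun h => filtration n.+1 (vecH v * h))).
  split=> [|a u w Hu Hw]; first by rewrite mulr0; exact: filtration0.
  by rewrite mulrDr scaleMr; exact: filtrationP.
move=> g W Wn; rewrite mulrA vecH_grpH -mulrA; apply: filtration_grpM.
have L i : filtration n.+1 (letter i * wordH W).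
  rewrite -wordH_cons -[X in filtration _ X]mul1r -(grpH1 m c).
  exact: filtration_word.
rewrite vecH_letters !mulrDl !scaleMl.
apply: filtrationD; [apply: filtrationD; [apply: filtrationD|]|];
  exact: filtrationZ.
Qed.

Lemma filtration_wordM n W h : filtration n h -> filtration (size W + n) (wordH W * h).
Proof.
move=> hn; elim: W => [|i W IHW]; first by rewrite wordH_nil mul1r.
by rewrite wordH_cons -mulrA; exact: filtration_vecM.
Qed.

Lemma filtrationM n l h k : filtration n.+1 h -> filtration l k ->
  filtration (n + l) (h * k).
Proof.
move=> hn kl; move: h hn.
apply: (filtration_ind (S := fun h => filtration (n + l) (h * k))).
  split=> [|a u v Hu Hv]; first by rewrite mul0r; exact: filtration0.
  by rewrite mulrDl scaleMl; exact: filtrationP.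
move=> g W Wn; rewrite -mulrA; apply: filtration_grpM.
by apply: (@filtrationW (size W + l)); [lia|exact: filtration_wordM].
Qed.

Lemma filtration_exhaustive h : exists n, filtration n h.
Proof.
elim/cls_ind: h; elim=> [v|g|||p [n pn] q [l ql]|p [n pn] q [l ql]|a p [n pn]].
- exists 2; rewrite -[cls _]mulr1 -(grpH1 m c); apply: filtration_vecM.
  exact: filtration_grp.
- by exists 1%N; exact: filtration_grp.
- by exists 1%N; rewrite -[cls _](grpH1 m c); exact: filtration_grp.
- by exists 1%N; exact: filtration0.
- exists (maxn n l); rewrite clsDE; apply: filtrationD.
    by apply: filtrationW pn; exact: leq_maxl.
  by apply: filtrationW ql; exact: leq_maxr.
- by exists (n + l)%N; rewrite clsME; apply: filtrationM => //; exact: filtrationW pn.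
- by exists n; rewrite clsZE; exact: filtrationZ.
Qed.

Lemma letter_comm i j : filtration 1 (letter i * letter j - letter j * letter i).
Proof.
have ED r u : filtration 1 (vecH (Defs.inE u) * vecH (inEdual r)
    - vecH (inEdual r) * vecH (Defs.inE u)).
  rewrite vecE_vecD -(addrA (_ * _)) addrAC subrr add0r /reflection_part.
  apply: filtrationB; first by apply: filtrationZ; rewrite -(grpH1 m c); exact: filtration_grp.
  apply: filtrationZ; apply: filtration_sum => k; apply: filtrationZ; exact: filtration_grp.
have DE r u : filtration 1 (vecH (inEdual r) * vecH (Defs.inE u)
    - vecH (Defs.inE u) * vecH (inEdual r)).
  by have := filtrationZ (-1) (ED r u); rewrite scaleN1r opprB.
have comm0 h k : h * k = k * h -> filtration 1 (h * k - k * h).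
  by move=> ->; rewrite subrr; exact: filtration0.
elim/forall_I4: i; elim/forall_I4: j;
  solve [exact: DE | exact: ED | apply: comm0; exact: vecE_comm
        | apply: comm0; exact: vecD_comm].
Qed.

Lemma filtration_wordH W : filtration (size W).+1 (wordH W).
Proof. by rewrite -[wordH W]mul1r -(grpH1 m c); exact: filtration_word. Qed.

Lemma word_move U i V : filtration (size (i :: U ++ V))
  (wordH (U ++ i :: V) - wordH (i :: U ++ V)).
Proof.
elim: U => [|j U IHU] /=; first by rewrite subrr; exact: filtration0.
rewrite !wordH_cons -(subrK (letter j * (letter i * wordH (U ++ V)))
  (letter j * wordH (U ++ i :: V))) -addrA; apply: filtrationD.
  by rewrite -mulrBr -wordH_cons; exact: filtration_vecM.
rewrite !mulrA -mulrBl; apply: (@filtrationW (0 + (size (U ++ V)).+1)) => //.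
by apply: filtrationM; [exact: letter_comm|exact: filtration_wordH].
Qed.

Lemma word_perm W W' : perm_eq W W' -> filtration (size W) (wordH W - wordH W').
Proof.
elim: W W' => [|i W IHW] W' WW'.
  move/perm_size: (WW') => /esym/size0nil ->; rewrite subrr; exact: filtration0.
have iW' : i \in W' by rewrite -(perm_mem WW') mem_head.
case/path.splitPr: iW' WW' => U V WW'.
have {}WW' : perm_eq W (U ++ V)
  by rewrite -(perm_cons i) (perm_trans WW')// -[i :: V]cat1s perm_catCA.
rewrite -(subrK (wordH (i :: U ++ V)) (wordH (i :: W))) -addrA; apply: filtrationD.
  by rewrite !wordH_cons -mulrBr; apply: filtration_vecM; exact: IHW.
have := filtrationZ (-1) (@word_move U i V); rewrite scaleN1r opprB.
by rewrite /= -(perm_size WW').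
Qed.

Definition ordered W := sorted (fun i j : 'I_4 => (i <= j)%N) W.

Lemma ordered_exponents W W' : ordered W -> ordered W' ->
  exponents W = exponents W' -> W = W'.
Proof.
move=> oW oW' WW'; apply: (path.sorted_eq _ _ oW oW').
- by move=> i j k; exact: leq_trans.
- by move=> i j ij; apply/val_inj/eqP; rewrite eqn_leq.
apply/allP => i _ /=; rewrite -!exponentsE WW'; exact: eqxx.
Qed.

(** Letters commute modulo the group algebra, so that words may be sorted at
    the cost of terms of lower degree. *)
Lemma filtration_ordered n h : filtration n.+1 h ->
  exists2 z : n.-tuple 'I_4 -> H, forall W : n.-tuple 'I_4, filtration 1 (z W) &
    filtration n (h - \sum_(W : n.-tuple 'I_4 | ordered W) z W * wordH W).
Proof.
pose S h := exists2 z : n.-tuple 'I_4 -> H, forall W : n.-tuple 'I_4, filtration 1 (z W) &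
    filtration n (h - \sum_(W : n.-tuple 'I_4 | ordered W) z W * wordH W).
apply: (filtration_ind (S := S)).
  split=> [|a u v [zu zu1 Hu] [zv zv1 Hv]].
    exists (fun=> 0) => [_|]; first exact: filtration0.
    by rewrite big1 ?subr0 => [|W _]; [exact: filtration0|rewrite mul0r].
  exists (fun W : n.-tuple 'I_4 => a *: zu W + zv W) => [W|]; first exact: filtrationP.
  rewrite (eq_bigr (fun W : n.-tuple 'I_4 => a *: (zu W * wordH W) + zv W * wordH W)); last first.
    by move=> W _; rewrite mulrDl scaleMl.
  rewrite big_split /= -scaler_sumr opprD addrACA -scalerBr.
  exact: filtrationP.
move=> g W Wn; have [Wlt|nW] := ltnP (size W) n.
  exists (fun=> 0) => [_|]; first exact: filtration0.
  by rewrite big1 ?subr0 => [|? _]; [exact: filtration_word|rewrite mul0r].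
have {nW}Wsz : size W = n by apply/eqP; rewrite eqn_leq nW andbT -ltnS.
set le4 := fun i j : 'I_4 => (i <= j)%N.
have sW : size (path.sort le4 W) == n by rewrite path.size_sort Wsz.
pose T := Tuple sW.
exists (fun W' : n.-tuple 'I_4 => if W' == T then grpH g else 0) => [W'|].
  by case: ifP => _; [exact: filtration_grp|exact: filtration0].
rewrite (bigD1 T) /=; last by apply: path.sort_sorted => i j; exact: leq_total.
rewrite eqxx big1 ?addr0 => [|W' /andP[_ /negbTE ->]]; last by rewrite mul0r.
rewrite -mulrBr; apply: filtration_grpM; rewrite -Wsz; apply: word_perm.
by rewrite perm_sym path.perm_sort.
Qed.

(** Multiplication by a group element on the left translates leading terms and
    leaves their polynomial factor unchanged. *)
Lemma normal_form_groupM n z h f : filtration 1 z -> has_symbol n h f ->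
  forall g, deg_lt n (normal_form (z * h) g - normal_form z g * f).
Proof.
move=> z1 hf; pose S z := forall g, deg_lt n (normal_form (z * h) g - normal_form z g * f).
apply: (filtration_ind (S := S)) z1.
  split=> [|a u v Hu Hv] g; first by rewrite mul0r normal_form0 mul0r subr0; exact: deg_lt_0.
  rewrite mulrDl scaleMl !normal_formD !normal_formZ !fctE !scaleME.
  have -> : scal a * normal_form (u * h) g + normal_form (v * h) g -
     (scal a * normal_form u g + normal_form v g) * f =
     scal a * (normal_form (u * h) g - normal_form u g * f)
      + (normal_form (v * h) g - normal_form v g * f) by ring.
  by apply: deg_ltD; [exact: deg_lt_scal|exact: Hv].
move=> k [|//] _ g; rewrite wordH_nil mulr1 normal_form_grpM -[grpH k]mulr1.
by rewrite normal_form_grpM normal_form1 !shiftME; case: hf => _; exact.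
Qed.

Lemma normal_form_group z g : filtration 1 z -> exists a, normal_form z g = scal a.
Proof.
apply: (filtration_ind (S := fun z => exists a, normal_form z g = scal a)).
  split=> [|a u v [b Hu] [d Hv]]; first by exists 0; rewrite normal_form0 rmorph0.
  by exists (a * b + d); rewrite normal_formD normal_formZ !fctE scaleME Hu Hv rmorphD rmorphM.
move=> k [|//] _; exists (mulG g k == oneG R m)%:R.
by rewrite wordH_nil normal_form_grpM normal_form1 shiftME /vacuum rmorph_nat.
Qed.

(** The action on functions is by right translation, which moves the
    component of [g] to [invG g]. *)
Definition group_coef z g : C := pcoef mnm0 (normal_form z (invG g)).

Lemma group_coefP z g : filtration 1 z -> normal_form z (invG g) = scal (group_coef z g).
Proof.
move=> /(normal_form_group (invG g))[a za]; rewrite /group_coef za.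
by rewrite -[scal a]mulr1 pcoef_scalM pcoef_1 eqxx !mulr1.
Qed.

Lemma group_coef_linear a (u v : H) g :
  group_coef (a *: u + v) g = a * group_coef u g + group_coef v g.
Proof.
by rewrite /group_coef normal_formD normal_formZ fctE scaleME raddfD /= pcoef_scalM.
Qed.

Lemma group_coef_grp (k g : G) : group_coef (grpH k) g = (g == k)%:R.
Proof.
rewrite /group_coef -[grpH k]mulr1 normal_form_grpM normal_form1 shiftME /vacuum.
have -> : (mulG (invG g) k == oneG R m) = (g == k).
  apply/eqP/eqP => [gk|->]; last exact: mulVG.
  by rewrite -[g]mulG1 -gk mulGA mulGV mul1G.
case: eqP => _; first by rewrite pcoef_1 eqxx.
exact: raddf0.
Qed.

Lemma group_expansion z : filtration 1 z ->
  exists2 S : {fset G}, forall g, g \notin S -> group_coef z g = 0 &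
    z = \sum_(g <- S) group_coef z g *: grpH g.
Proof.
pose K z := exists2 S : {fset G}, forall g, g \notin S -> group_coef z g = 0 &
    z = \sum_(g <- S) group_coef z g *: grpH g.
apply: (filtration_ind (S := K)); last first.
  move=> k [|//] _; rewrite wordH_nil mulr1; exists [fset k]%fset.
    by move=> g; rewrite in_fset1 group_coef_grp => /negbTE->.
  by rewrite big_seq_fset1 group_coef_grp eqxx scale1r.
split=> [|a u v [S S0 uS] [T T0 vT]].
  exists fset0 => [g _|]; last by rewrite big_seq_fset0.
  by rewrite /group_coef normal_form0 raddf0.
exists (S `|` T)%fset => [g|].
  rewrite inE negb_or group_coef_linear => /andP[gS gT].
  by rewrite S0// T0// mulr0 addr0.
under eq_bigr do rewrite group_coef_linear scalerDl -scalerA.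
rewrite big_split /= -scaler_sumr {1}uS {1}vT; congr (_ *: _ + _).
  apply: big_fset_incl; first exact: fsubsetUl.
  by move=> g _ gS; rewrite S0// scale0r.
apply: big_fset_incl; first exact: fsubsetUr.
by move=> g _ gT; rewrite T0// scale0r.
Qed.

Lemma group_coef_inj z : filtration 1 z -> (forall g, group_coef z g = 0) -> z = 0.
Proof.
move=> /group_expansion[S _ zE] z0; rewrite zE big1// => g _.
by rewrite z0 scale0r.
Qed.

Lemma deg_lt_filtration n h g : filtration n h -> deg_lt n (normal_form h g).
Proof.
apply: (filtration_ind (S := fun h => deg_lt n (normal_form h g))).
  split=> [|a u v Hu Hv]; first by rewrite normal_form0; exact: deg_lt_0.
  rewrite normal_formD normal_formZ; apply: deg_ltD => //; exact: deg_lt_scal.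
move=> k W Wn; rewrite normal_form_grpM shiftME; apply: deg_ltW Wn _.
exact: deg_lt_normal_form (has_symbol_word W).
Qed.

Lemma normal_form_sum (I : Type) (s : seq I) (P : pred I) (F : I -> H) g :
  normal_form (\sum_(i <- s | P i) F i) g = \sum_(i <- s | P i) normal_form (F i) g.
Proof.
apply: (big_morph (fun h => normal_form h g)) => [h k|].
  by rewrite normal_formD.
by rewrite normal_form0.
Qed.

(** The Poincare-Birkhoff-Witt theorem: ordered words have distinct monomials
    as their symbols, so that an element is determined modulo lower degree by
    the top coefficients of its normal form. *)
Lemma filtration_top n h : filtration n.+1 h ->
  (forall g e, mdeg e = n -> pcoef e (normal_form h g) = 0) -> filtration n h.
Proof.
move=> /filtration_ordered[z z1 hz] h0.
set h' := \sum_(W : n.-tuple 'I_4 | _) _ in hz.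
suff h'0 : h' = 0 by rewrite h'0 subr0 in hz.
apply: big1 => W0 oW0; rewrite (group_coef_inj (z1 W0)) ?mul0r// => g.
set e := exponents W0.
have en : mdeg e = n by rewrite mdeg_exponents size_tuple.
have h'e : pcoef e (normal_form h' (invG g)) = 0.
  have := deg_lt_filtration (invG g) hz; rewrite normal_formB !fctE => /(_ e).
  by rewrite en raddfB /= h0// sub0r => /(_ (leqnn _))/eqP; rewrite oppr_eq0 => /eqP.
rewrite -[RHS]h'e normal_form_sum raddf_sum (bigD1 W0)//= [X in _ + X]big1 ?addr0.
  have /(_ e) := normal_form_groupM (z1 W0) (has_symbol_word W0) (invG g).
  rewrite size_tuple en leqnn => /(_ isT)/eqP; rewrite raddfB subr_eq0 => /eqP /= ->.
  by rewrite group_coefP// pcoef_scalM pcoef_word eqxx mulr1.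
move=> W /andP[oW WW0].
have /(_ e) := normal_form_groupM (z1 W) (has_symbol_word W) (invG g).
rewrite size_tuple en leqnn => /(_ isT)/eqP; rewrite raddfB subr_eq0 => /eqP /= ->.
rewrite group_coefP// pcoef_scalM pcoef_word; case: eqP => [eW|_]; last by rewrite mulr0.
case/eqP: WW0; apply: val_inj; exact/esym/(ordered_exponents oW0 oW eW).
Qed.

(** The coefficient of a monomial of top degree, as an element of the group
    algebra. *)
Lemma top_coefficient n h e : filtration n.+1 h -> mdeg e = n ->
  exists2 z, filtration 1 z &
    forall g, pcoef e (normal_form h g) = pcoef mnm0 (normal_form z g).
Proof.
move=> hn en; pose K h := exists2 z, filtration 1 z &
  forall g, pcoef e (normal_form h g) = pcoef mnm0 (normal_form z g).
apply: (filtration_ind (S := K)) hn.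
  split=> [|a u v [z z1 uz] [y y1 vy]].
    by exists 0 => [|g]; [exact: filtration0|rewrite normal_form0 !raddf0].
  exists (a *: z + y) => [|g]; first exact: filtrationP.
  by rewrite !normal_formD !normal_formZ !fctE !scaleME !raddfD /= !pcoef_scalM uz vy.
move=> k W Wn; exists (pcoef e (wordA W) *: grpH k) => [|g].
  by apply: filtrationZ; exact: filtration_grp.
have [_ /(_ (mulG g k) e)] := has_symbol_word W.
rewrite en -ltnS => /(_ Wn)/eqP.
rewrite raddfB subr_eq0 normal_form_grpM shiftME => /eqP /= ->.
rewrite normal_formZ scaleME pcoef_scalM -[grpH k]mulr1 normal_form_grpM.
rewrite normal_form1 shiftME /vacuum; case: eqP => _.
  by rewrite mul1r pcoef_1 eqxx mulr1.
by rewrite mul0r !raddf0 mulr0.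
Qed.

Section Derivation.
Variables (E : H) (s : 'I_4 -> phase R).

Hypothesis E_letter : forall i, E * letter i - letter i * E = vecH (s i).
Hypothesis E_grp : forall g, E * grpH g = grpH g * E.

Definition symbol_derivation f : A := \sum_i linear_form (s i) * pderiv i f.

Lemma symbol_derivationM f f' : symbol_derivation (f * f') =
  symbol_derivation f * f' + f * symbol_derivation f'.
Proof.
rewrite /symbol_derivation mulr_suml mulr_sumr -big_split; apply: eq_bigr => i _ /=.
rewrite pderivM; ring.
Qed.

Lemma symbol_derivation_var i : symbol_derivation (var i) = linear_form (s i).
Proof.
rewrite /symbol_derivation (bigD1 i)//= pderiv_var eqxx mulr1 big1 ?addr0// => j ji.
by rewrite pderiv_var (negbTE ji) mulr0.
Qed.

Lemma deg_lt_linear_form n v f : deg_lt n f -> deg_lt n.+1 (linear_form v * f).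
Proof.
by move=> fn; rewrite mulrDl; apply: deg_ltD; [exact: deg_lt_coordinate|exact: deg_lt_momentum].
Qed.

Lemma deg_lt_symbol_derivation n f : deg_lt n f -> deg_lt n (symbol_derivation f).
Proof.
case: n => [|n] fn.
  by rewrite (deg_lt_eq0 fn) /symbol_derivation big1 => [|i _];
    [exact: deg_lt_0|rewrite raddf0 mulr0].
by apply: deg_lt_sum => i; apply/deg_lt_linear_form/deg_lt_deriv.
Qed.

Lemma symbol_derivation_linear a f f' :
  symbol_derivation (scal a * f + f') = scal a * symbol_derivation f + symbol_derivation f'.
Proof.
rewrite /symbol_derivation mulr_sumr -big_split; apply: eq_bigr => i _ /=.
by rewrite raddfD /= pderivM pderiv_scal; ring.
Qed.

Lemma has_symbol_bracket_word W : has_symbol (size W) (E * wordH W - wordH W * E)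
  (symbol_derivation (wordA W)).
Proof.
elim: W => [|i W IHW].
  rewrite wordH_nil mulr1 mul1r subrr /wordA big_nil.
  rewrite (_ : symbol_derivation 1 = 0); first exact: has_symbol0.
  by apply: big1 => i _; rewrite -(rmorph1 scal) pderiv_scal mulr0.
rewrite wordH_cons /wordA big_cons -/(wordA W) symbol_derivationM symbol_derivation_var.
have -> : E * (letter i * wordH W) - letter i * wordH W * E =
    vecH (s i) * wordH W + vecH (letterV R i) * (E * wordH W - wordH W * E).
  by rewrite -E_letter mulrBl mulrBr !mulrA addrA subrK.
rewrite -[var i]linear_form_letter; apply: has_symbolD; apply: has_symbol_vec => //.
exact: has_symbol_word.
Qed.

(** On leading terms the bracket with [E] is the derivation which it induces
    on symbols. *)
Lemma bracket_symbol n h g : filtration n.+1 h ->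
  deg_lt n (normal_form (E * h - h * E) g - symbol_derivation (normal_form h g)).
Proof.
move=> hn; pose K h := deg_lt n
  (normal_form (E * h - h * E) g - symbol_derivation (normal_form h g)).
apply: (filtration_ind (S := K)) hn.
  split=> [|a u v Hu Hv]; rewrite /K.
    rewrite mulr0 mul0r subrr normal_form0 sub0r.
    by apply/deg_ltN/deg_lt_symbol_derivation; exact: deg_lt_0.
  have -> : E * (a *: u + v) - (a *: u + v) * E =
      a *: (E * u - u * E) + (E * v - v * E).
    by rewrite mulrDr mulrDl scaleMl scaleMr opprD addrACA scalerBr.
  rewrite (normal_formD (a *: (_ - _))) (normal_formD (a *: u)) !normal_formZ.
  rewrite !fctE !scaleME symbol_derivation_linear.
  by rewrite opprD addrACA -mulrBr; apply: deg_ltD => //; exact: deg_lt_scal.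
move=> k W; rewrite ltnS => Wn; rewrite /K mulrA E_grp -!mulrA -mulrBr.
rewrite !normal_form_grpM !shiftME; set l := mulG g k.
apply: deg_ltW Wn _.
have [_ /(_ l)] := has_symbol_bracket_word W.
have [_ /(_ l)/deg_lt_symbol_derivation] := has_symbol_word W.
set f := normal_form _ _; set f' := normal_form _ _.
have -> : f - vacuum l * wordA W = scal (-1) * (vacuum l * wordA W) + f.
  by rewrite rmorphN1 mulN1r addrC.
rewrite symbol_derivation_linear rmorphN1 mulN1r.
have -> : symbol_derivation (vacuum l * wordA W) = vacuum l * symbol_derivation (wordA W).
  rewrite !vacuumE; case: eqP => // _; apply: big1 => i _; rewrite raddf0 mulr0 //.
by move=> f1 f2; have := deg_ltB f2 f1; rewrite opprD opprK addrA subrK.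
Qed.

End Derivation.

End Symbols.

(** * The triple acts by derivations *)

Section LieAlgebra.
Variables (R : realType) (m : nat) (c : 'M[R]_2 -> R[i]).
Local Notation C := R[i].
Local Notation G := (dihedral R m).
Local Notation H := (cherednik m c).
Local Notation grpH := (@grpH R m c).
Local Notation vecH := (@vecH R m c).
Local Notation letter := (@letter R m c).
Local Notation cmx := (map_mx (real_complex R)).
Local Notation alpha j := (alpha_ R m j.+1).
Local Notation acov j := (acov_ R m j.+1).
Local Notation wt j := (c (srefl R m j.+1)).
Local Notation vecE u := (vecH (Defs.inE u)).
Local Notation vecD r := (vecH (inEdual r)).
Local Notation Eplus := (@Eplus R m c).
Local Notation Eminus := (@Eminus R m c).
Local Notation Z0 := (@Z0 R m c).
Local Notation rpart := (@reflection_part R m c).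
Implicit Types (a b : C) (g : G) (h k p q : H).
Implicit Types (u : 'cV[R]_2) (r : 'rV[R]_2).

Lemma vecE_expand u : vecE u = (u 0 0)%:C *: hxi m c + (u 1 0)%:C *: heta m c.
Proof.
by rewrite vecH_letters /= !mxE !scale0r !add0r.
Qed.

Lemma vecD_expand r : vecD r = (r 0 0)%:C *: hx m c + (r 0 1)%:C *: hy m c.
Proof.
by rewrite vecH_letters /= !mxE !scale0r !addr0.
Qed.

Lemma root_coordinates (j : 'I_m) :
  [/\ pairing (xE R) (alpha j) = alpha j 0 0, pairing (yE R) (alpha j) = alpha j 1 0,
      pairing (acov j) (xiE R) = alpha j 0 0 & pairing (acov j) (etaE R) = alpha j 1 0].
Proof.
rewrite /pairing acovE !mulmx_I2 /xE /yE /xiE /etaE ord_max_I2.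
by move: (alpha_ R m j.+1) => al; split; rewrite !mxE /=; ring.
Qed.

Lemma root_norm (j : 'I_m) : alpha j 0 0 ^+ 2 + alpha j 1 0 ^+ 2 = 1.
Proof.
have := congr1 (fun M : 'M[R]_1 => M 0 0) (alpha_unit R m j.+1).
by rewrite /= mulmx_I2 ![_^T _ _]mxE -!expr2 => ->; rewrite mxE.
Qed.

Lemma drefl_root (j : 'I_m) : grpH (drefl R j) * vecE (alpha j) = - (vecE (alpha j) * grpH (drefl R j)).
Proof.
rewrite grpH_vecH -mulNr -scaleN1r -vecHZ; congr (vecH _ * _).
rewrite /act /Defs.inE /= -map_mxM reflection_vec ?alpha_unit//.
by congr (_, _); rewrite ?mul0mx ?scaler0// map_mxN scaleN1r.
Qed.

Lemma drefl_coroot (j : 'I_m) : grpH (drefl R j) * vecD (acov j) = - (vecD (acov j) * grpH (drefl R j)).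
Proof.
rewrite grpH_vecH -mulNr -scaleN1r -vecHZ; congr (vecH _ * _).
rewrite /act /inEdual /= -map_mxM orthogonal_inv; last exact: srefl_orthogonal.
congr (_, _); first by rewrite mulmx0 scaler0.
by rewrite acovE -trmx_mul reflection_vec ?alpha_unit// linearN /= map_mxN scaleN1r.
Qed.

(** To be applied to the roots of the reflections, or to their coroots. *)
Lemma reflection_sum_cancel (V : 'I_m -> H) (w : 'I_m -> C) :
  (forall j, grpH (drefl R j) * V j = - (V j * grpH (drefl R j))) ->
  \sum_(j < m) w j *: (V j * grpH (drefl R j))
    + \sum_(j < m) w j *: (grpH (drefl R j) * V j) = 0.
Proof.
by move=> VA; rewrite -big_split big1// => j _ /=; rewrite VA scalerN subrr.
Qed.

Lemma bracket_sqr h k (l : H) : k * h = h * k + l -> k * h ^+ 2 = h ^+ 2 * k + (h * l + l * h).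
Proof.
by move=> kh; rewrite expr2 mulrA kh mulrDl -(mulrA h k) kh mulrDr !mulrA addrA.
Qed.

Lemma sqr_bracket h k (l : H) : k * h = h * k + l -> k ^+ 2 * h = h * k ^+ 2 + (l * k + k * l).
Proof.
by move=> kh; rewrite expr2 -mulrA kh mulrDr mulrA kh mulrDl -!mulrA addrA.
Qed.

Lemma anticommutator_affine a h (s : H) : h * (a *: (1 : H) - s) + (a *: (1 : H) - s) * h =
  2 *: (a *: h) - (h * s + s * h).
Proof.
rewrite mulrBr mulrBl scaleMl scaleMr mulr1 mul1r addrACA -opprD.
by rewrite scaler_nat mulr2n.
Qed.

(** Commuting past [x^2 + y^2] produces no reflections: those coming from [x]
    and from [y] add up to anticommutators of reflections with their own
    roots. *)
Lemma vecE_norm u : vecE u * (hx m c ^+ 2 + hy m c ^+ 2) =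
  (hx m c ^+ 2 + hy m c ^+ 2) * vecE u
  + 2 *: ((pairing (xE R) u)%:C *: hx m c + (pairing (yE R) u)%:C *: hy m c).
Proof.
have E : vecD (xE R) * rpart (xE R) u + vecD (yE R) * rpart (yE R) u =
    2 *: \sum_(j < m) (wt j * (pairing (acov j) u)%:C) *: (vecD (acov j) * grpH (drefl R j)).
  rewrite /reflection_part !scaleMr -scalerDr; congr (_ *: _).
  rewrite !mulr_sumr -big_split; apply: eq_bigr => j _ /=.
  have [-> -> _ _] := root_coordinates j.
  rewrite [vecD (acov j)]vecD_expand acovE ![_^T _ _]mxE mulrDl !scaleMl !scaleMr.
  by rewrite scalerDr !scalerA; congr (_ *: _ + _ *: _); ring.
have E' : rpart (xE R) u * vecD (xE R) + rpart (yE R) u * vecD (yE R) =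
    2 *: \sum_(j < m) (wt j * (pairing (acov j) u)%:C) *: (grpH (drefl R j) * vecD (acov j)).
  rewrite /reflection_part !scaleMl -scalerDr; congr (_ *: _).
  rewrite !mulr_suml -big_split; apply: eq_bigr => j _ /=.
  have [-> -> _ _] := root_coordinates j.
  rewrite [vecD (acov j)]vecD_expand acovE ![_^T _ _]mxE mulrDr !scaleMl !scaleMr.
  by rewrite scalerDr !scalerA; congr (_ *: _ + _ *: _); ring.
have comm r : vecE u * vecD r ^+ 2 = vecD r ^+ 2 * vecE u
    + (2 *: ((pairing r u)%:C *: vecD r) - (vecD r * rpart r u + rpart r u * vecD r)).
  by rewrite -anticommutator_affine; apply: bracket_sqr; rewrite vecE_vecD addrA.
rewrite mulrDr (comm (xE R)) (comm (yE R)) addrACA -mulrDl; congr (_ + _).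
rewrite addrACA -opprD (addrACA (vecD _ * _)) E E' -scalerDr.
have /= Z := reflection_sum_cancel (fun j => wt j * (pairing (acov j) u)%:C) drefl_coroot.
by rewrite -[X in _ - X]scalerDr Z scaler0 subr0.
Qed.

Lemma norm_vecD r : (hxi m c ^+ 2 + heta m c ^+ 2) * vecD r =
  vecD r * (hxi m c ^+ 2 + heta m c ^+ 2)
  + 2 *: ((pairing r (xiE R))%:C *: hxi m c + (pairing r (etaE R))%:C *: heta m c).
Proof.
have E : vecE (xiE R) * rpart r (xiE R) + vecE (etaE R) * rpart r (etaE R) =
    2 *: \sum_(j < m) (wt j * (pairing r (alpha j))%:C) *: (vecE (alpha j) * grpH (drefl R j)).
  rewrite /reflection_part !scaleMr -scalerDr; congr (_ *: _).
  rewrite !mulr_sumr -big_split; apply: eq_bigr => j _ /=.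
  have [_ _ -> ->] := root_coordinates j.
  rewrite [vecE (alpha j)]vecE_expand mulrDl !scaleMl !scaleMr.
  by rewrite scalerDr !scalerA; congr (_ *: _ + _ *: _); ring.
have E' : rpart r (xiE R) * vecE (xiE R) + rpart r (etaE R) * vecE (etaE R) =
    2 *: \sum_(j < m) (wt j * (pairing r (alpha j))%:C) *: (grpH (drefl R j) * vecE (alpha j)).
  rewrite /reflection_part !scaleMl -scalerDr; congr (_ *: _).
  rewrite !mulr_suml -big_split; apply: eq_bigr => j _ /=.
  have [_ _ -> ->] := root_coordinates j.
  rewrite [vecE (alpha j)]vecE_expand mulrDr !scaleMl !scaleMr.
  by rewrite scalerDr !scalerA; congr (_ *: _ + _ *: _); ring.
have comm u : vecE u ^+ 2 * vecD r = vecD r * vecE u ^+ 2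
    + (2 *: ((pairing r u)%:C *: vecE u) - (vecE u * rpart r u + rpart r u * vecE u)).
  rewrite -anticommutator_affine [X in _ + X]addrC; apply: sqr_bracket.
  by rewrite vecE_vecD addrA.
rewrite mulrDl (comm (xiE R)) (comm (etaE R)) addrACA -mulrDr; congr (_ + _).
rewrite addrACA -opprD (addrACA (vecE _ * _)) E E' -scalerDr.
have /= Z := reflection_sum_cancel (fun j => wt j * (pairing r (alpha j))%:C) drefl_root.
by rewrite -[X in _ - X]scalerDr Z scaler0 subr0.
Qed.

Lemma scale_halfK h : 2^-1 *: (2 *: h) = h.
Proof. by rewrite scalerA mulVf ?scale1r// pnatr_eq0. Qed.

(** [ad E_+] and [ad E_-] are, up to sign, the derivations sending [xi], [eta]
    to [x], [y] and conversely. *)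
Definition raise (i : 'I_4) : phase R := [:: 0; 0; - inEdual (xE R); - inEdual (yE R)]`_i.
Definition lower (i : 'I_4) : phase R := [:: - Defs.inE (xiE R); - Defs.inE (etaE R); 0; 0]`_i.

Lemma vecHN (v : phase R) : vecH (- v) = - vecH v.
Proof. by rewrite -scaleN1r vecHZ scaleN1r. Qed.

Lemma pairing_basis : [/\ pairing (xE R) (xiE R) = 1, pairing (xE R) (etaE R) = 0,
  pairing (yE R) (xiE R) = 0 & pairing (yE R) (etaE R) = 1].
Proof.
rewrite /pairing !mulmx_I2 /xE /yE /xiE /etaE ord_max_I2.
by split; rewrite !mxE /=; ring.
Qed.

Lemma Eplus_letter i : Eplus * letter i - letter i * Eplus = vecH (raise i).
Proof.
have dual r : Eplus * vecD r - vecD r * Eplus = 0.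
  rewrite /Defs.Eplus scaleMl scaleMr -scalerBr mulrDl mulrDr opprD addrACA.
  have comm r' : vecD r' ^+ 2 * vecD r - vecD r * vecD r' ^+ 2 = 0.
    by apply/eqP; rewrite subr_eq0; apply/eqP/esym/commrX; exact: vecD_comm.
  by rewrite (comm (xE R)) (comm (yE R)) addr0 scaler0.
have vec u : Eplus * vecE u - vecE u * Eplus =
    - ((pairing (xE R) u)%:C *: hx m c + (pairing (yE R) u)%:C *: hy m c).
  rewrite /Defs.Eplus scaleMl scaleMr -scalerBr vecE_norm opprD addrA subrr sub0r.
  by rewrite scalerN scale_halfK.
have [px qx py qy] := pairing_basis.
elim/forall_I4: i; rewrite /raise /= ?vecH0 ?vecHN; [exact: dual|exact: dual| |].
- by rewrite (vec (xiE R)) px py !rmorph1 !rmorph0 scale1r scale0r addr0.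
- by rewrite (vec (etaE R)) qx qy !rmorph1 !rmorph0 scale1r scale0r add0r.
Qed.

Lemma Eminus_letter i : Eminus * letter i - letter i * Eminus = vecH (lower i).
Proof.
have vec u : Eminus * vecE u - vecE u * Eminus = 0.
  rewrite /Defs.Eminus mulNr mulrN -opprD scaleMl scaleMr -scalerBr.
  rewrite mulrDl mulrDr opprD addrACA.
  have comm u' : vecE u' ^+ 2 * vecE u - vecE u * vecE u' ^+ 2 = 0.
    by apply/eqP; rewrite subr_eq0; apply/eqP/esym/commrX; exact: vecE_comm.
  by rewrite (comm (xiE R)) (comm (etaE R)) addr0 scaler0 oppr0.
have dual r : Eminus * vecD r - vecD r * Eminus =
    - ((pairing r (xiE R))%:C *: hxi m c + (pairing r (etaE R))%:C *: heta m c).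
  rewrite /Defs.Eminus mulNr mulrN -opprD scaleMl scaleMr -scalerBr norm_vecD.
  by rewrite addrAC subrr add0r scale_halfK.
have [px qx py qy] := pairing_basis.
elim/forall_I4: i; rewrite /lower /= ?vecH0 ?vecHN; [| |exact: vec|exact: vec].
- by rewrite (dual (xE R)) px qx !rmorph1 !rmorph0 scale1r scale0r addr0.
- by rewrite (dual (yE R)) py qy !rmorph1 !rmorph0 scale1r scale0r add0r.
Qed.

(** The reflections of the brackets of [xi] with [x] and of [eta] with [y] add
    up to [2 sigma], the roots being unit vectors. *)
Lemma Hweight_bracket : Hweight m c = Eplus * Eminus - Eminus * Eplus.
Proof.
have bracket_norm k (l l' : H) : Eplus * k - k * Eplus = l ->
    Eplus * (k ^+ 2) - k ^+ 2 * Eplus = l * k + k * l.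
  by move=> <-; rewrite expr2 mulrBl mulrBr !mulrA addrA subrK.
have -> : Eplus * Eminus - Eminus * Eplus =
    - (2^-1 *: ((Eplus * hxi m c ^+ 2 - hxi m c ^+ 2 * Eplus)
                + (Eplus * heta m c ^+ 2 - heta m c ^+ 2 * Eplus))).
  rewrite [in LHS]/Defs.Eminus mulrN mulNr (scaleMl _ _ Eplus) scaleMr -opprD -scalerBr.
  by rewrite mulrDr mulrDl opprD addrACA.
rewrite (bracket_norm (hxi m c) _ 0 (Eplus_letter 2)).
rewrite (bracket_norm (heta m c) _ 0 (Eplus_letter 3)) /raise /= !vecHN.
rewrite !mulNr !mulrN -!opprD scalerN opprK.
have -> : hxi m c * vecD (xE R) = hx m c * hxi m c + 1 - rpart (xE R) (xiE R).
  by have [px _ _ _] := pairing_basis; rewrite [LHS]vecE_vecD px rmorph1 scale1r.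
have -> : heta m c * vecD (yE R) = hy m c * heta m c + 1 - rpart (yE R) (etaE R).
  by have [_ _ _ qy] := pairing_basis; rewrite [LHS]vecE_vecD qy rmorph1 scale1r.
have E : rpart (xE R) (xiE R) + rpart (yE R) (etaE R) = 2 *: sigma m c.
  rewrite /reflection_part -scalerDr -big_split; congr (_ *: _).
  apply: eq_bigr => j _ /=; have [-> -> -> ->] := root_coordinates j.
  rewrite -scalerDl -!mulrA -mulrDr -!rmorphM -rmorphD -!expr2 root_norm.
  by rewrite rmorph1 mulr1.
have -> : hx m c * hxi m c + (hx m c * hxi m c + 1 - rpart (xE R) (xiE R)) +
     (hy m c * heta m c + (hy m c * heta m c + 1 - rpart (yE R) (etaE R))) =
     2 *: Hweight m c.
  have -> : 2 *: Hweight m c = 2 *: (hx m c * hxi m c) + 2 *: (hy m c * heta m c)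
      + 2 *: (1 : H) - 2 *: sigma m c by rewrite scalerBr !scalerDr.
  by rewrite -E !scaler_nat !mulr2n opprD !addrA [LHS](ACl (1*2*5*6*3*7*4*8)).
by rewrite scale_halfK.
Qed.

Lemma grp_letters g : exists e : R, [/\ e ^+ 2 = 1, isometry_of_sign e (val g) &
  [/\ grpH g * hx m c = ((val g 0 0)%:C *: hx m c + (val g 1 0)%:C *: hy m c) * grpH g,
    grpH g * hy m c = ((val g 0 1)%:C *: hx m c + (val g 1 1)%:C *: hy m c) * grpH g,
    grpH g * hxi m c = ((val g 0 0)%:C *: hxi m c + (val g 1 0)%:C *: heta m c) * grpH g &
    grpH g * heta m c = ((val g 0 1)%:C *: hxi m c + (val g 1 1)%:C *: heta m c) * grpH g]].
Proof.
have [e e1 ge] := isometry_of_signP (orthG g); exists e; split=> //.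
have D r : grpH g * vecD r = vecD (r *m (val g)^T) * grpH g.
  rewrite grpH_vecH /act /= orthogonal_inv; last exact: orthG.
  by rewrite mulmx0 -map_mxM.
have V u : grpH g * vecE u = vecE (val g *m u) * grpH g.
  by rewrite grpH_vecH /act /= mul0mx -map_mxM.
split.
- rewrite [LHS]D vecD_expand !mulmx_I2 ![_^T _ _]mxE /xE !mxE /=.
  by rewrite !mul1r !mul0r !addr0.
- rewrite [LHS]D vecD_expand !mulmx_I2 ![_^T _ _]mxE /yE ord_max_I2 !mxE /=.
  by rewrite !mul1r !mul0r !add0r.
- rewrite [LHS]V vecE_expand !mulmx_I2 /xiE !mxE /=.
  by rewrite !mulr1 !mulr0 !addr0.
- rewrite [LHS]V vecE_expand !mulmx_I2 /etaE ord_max_I2 !mxE /=.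
  by rewrite !mulr1 !mulr0 !add0r.
Qed.

Lemma bilinear_expand (a a' b b' : C) (h k h' k' : H) :
  (a *: h + a' *: k) * (b *: h' + b' *: k') =
  (a * b) *: (h * h') + (a * b') *: (h * k') + (a' * b) *: (k * h') + (a' * b') *: (k * k').
Proof. by rewrite mulrDl !mulrDr !scaleMl !scaleMr !scalerA addrA. Qed.

Lemma grp_product g (h k h' k' : H) : grpH g * h = h' * grpH g -> grpH g * k = k' * grpH g ->
  grpH g * (h * k) = h' * k' * grpH g.
Proof. by move=> gh gk; rewrite mulrA gh -mulrA gk mulrA. Qed.

Lemma grp_norm g h k (a b a' b' : R) :
  a ^+ 2 + b ^+ 2 = 1 -> a' ^+ 2 + b' ^+ 2 = 1 -> a * a' + b * b' = 0 ->
  grpH g * h = (a%:C *: h + a'%:C *: k) * grpH g ->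
  grpH g * k = (b%:C *: h + b'%:C *: k) * grpH g ->
  grpH g * (h ^+ 2 + k ^+ 2) = (h ^+ 2 + k ^+ 2) * grpH g.
Proof.
move=> n1 n2 o12 gh gk; rewrite !expr2 mulrDr (grp_product gh gh) (grp_product gk gk).
rewrite -mulrDl; congr (_ * _); rewrite !bilinear_expand -!rmorphM /=.
rewrite addrACA [X in X + _]addrACA [X in X + _ + _]addrACA -!scalerDl -!rmorphD /=.
rewrite -!expr2 n1 n2 o12 [a' * a]mulrC [b' * b]mulrC o12.
by rewrite rmorph0 rmorph1 !scale0r !scale1r !addr0.
Qed.

Lemma grp_Eplus g : grpH g * Eplus = Eplus * grpH g.
Proof.
have [e [e1 [g11 g10 n1] [gx gy _ _]]] := grp_letters g.
rewrite /Defs.Eplus scaleMr scaleMl (grp_norm _ _ _ gx gy) ?g11 ?g10//.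
  by rewrite !exprMn sqrrN e1 !mul1r addrC.
by ring.
Qed.

Lemma grp_Eminus g : grpH g * Eminus = Eminus * grpH g.
Proof.
have [e [e1 [g11 g10 n1] [_ _ gx gy]]] := grp_letters g.
rewrite /Defs.Eminus mulrN mulNr scaleMr scaleMl (grp_norm _ _ _ gx gy) ?g11 ?g10//.
  by rewrite !exprMn sqrrN e1 !mul1r addrC.
by ring.
Qed.

(** [x eta - y xi] is a determinant, hence multiplied by that of [g]. *)
Lemma grp_Z0 g : exists2 e : R, e ^+ 2 = 1 &
  (val g *m cplxJ R = cplxJ R *m val g <-> e = 1) /\ grpH g * Z0 = e%:C *: (Z0 * grpH g).
Proof.
have [e [e1 ge [gx gy gxi geta]]] := grp_letters g; exists e => //.
split; first exact: commute_cplxJ.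
have [g11 g10 n1] := ge.
rewrite /Defs.Z0 scaleMr scaleMl scalerA (mulrC e%:C) -scalerA; congr (_ *: _).
rewrite mulrBr (grp_product gx geta) (grp_product gy gxi) -mulrBl -scaleMl.
congr (_ * _); rewrite !bilinear_expand -!rmorphM /=.
rewrite g11 g10 !opprD !addrA (ACl ((1*5)*(2*6)*(3*7)*(4*8))) /= -!scalerBl -!rmorphB /=.
set a := val g 0 0 in n1 *; set b := val g 0 1 in n1 *.
have -> : a * b - b * a = 0 by ring.
have -> : a * (e * a) - b * (- e * b) = e by rewrite -[RHS]mulr1 -n1; ring.
have -> : - e * b * b - e * a * a = - e by rewrite -[e in RHS]mulr1 -n1; ring.
have -> : - e * b * (e * a) - e * a * (- e * b) = 0 by ring.
by rewrite rmorph0 !scale0r add0r addr0 rmorphN scaleNr scalerBr.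
Qed.

Lemma comm_bracket0 (E h k l l' : H) : E * h - h * E = l -> E * k - k * E = l' ->
  E * (h * k) - h * k * E = l * k + h * l'.
Proof. by move=> <- <-; rewrite mulrBl mulrBr !mulrA addrA subrK. Qed.

Lemma bracket_scaleB (E h k : H) a : E * (a *: (h - k)) - a *: (h - k) * E =
  a *: ((E * h - h * E) - (E * k - k * E)).
Proof.
by rewrite scaleMr (scaleMl _ _ E) -scalerBr mulrBr mulrBl !opprD !opprK addrACA.
Qed.

Lemma comm_Z0_Eplus : GRing.comm Z0 Eplus.
Proof.
apply/esym/eqP; rewrite -subr_eq0 /Defs.Z0 bracket_scaleB.
rewrite (comm_bracket0 (Eplus_letter 0) (Eplus_letter 3)).
rewrite (comm_bracket0 (Eplus_letter 1) (Eplus_letter 2)).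
rewrite /raise /= vecH0 !vecHN !mul0r !add0r !mulrN [_ * vecD (yE R)]vecD_comm.
by rewrite subrr scaler0.
Qed.

Lemma comm_Z0_Eminus : GRing.comm Z0 Eminus.
Proof.
apply/esym/eqP; rewrite -subr_eq0 /Defs.Z0 bracket_scaleB.
rewrite (comm_bracket0 (Eminus_letter 0) (Eminus_letter 3)).
rewrite (comm_bracket0 (Eminus_letter 1) (Eminus_letter 2)).
rewrite /lower /= vecH0 !vecHN !mulr0 !addr0 !mulNr.
have -> : vecE (etaE R) * letter 2 = vecE (xiE R) * letter 3 by exact: vecE_comm.
by rewrite subrr scaler0.
Qed.

Hypothesis c_inv : conj_invariant m c.

Lemma grp_sigma g : GRing.comm (grpH g) (sigma m c).
Proof.
rewrite /GRing.comm /sigma mulr_sumr mulr_suml.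
have [p [e e1 pE]] := root_permutation g.
rewrite [RHS](reindex_inj (@perm_inj _ p)); apply: eq_bigr => j _ /=.
rewrite scaleMr scaleMl !grpHM (drefl_conj (e1 j) (pE j)).
by rewrite (conj_invariant_root c_inv (e1 j) (pE j)).
Qed.

End LieAlgebra.

(** * Invariant forms *)

Section Invariants.
Variables (C : numFieldType) (A : polynomial_ring C).
Local Notation var := (@var C A).
Local Notation pcoef := (@pcoef C A).
Local Notation pderiv := (@pderiv C A).
Implicit Types (f : A) (n a b d e : nat).

Definition exponent a b d e : multinom 4 := Multinom [tuple a; b; d; e].

Lemma exponentE a b d e : [/\ exponent a b d e 0 = a, exponent a b d e 1 = b,
  exponent a b d e 2 = d & exponent a b d e 3 = e].
Proof. by split; rewrite mnm_tnth. Qed.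

Lemma exponentP (k : multinom 4) : k = exponent (k 0) (k 1) (k 2) (k 3).
Proof.
apply/mnmP; have [k0 k1 k2 k3] := exponentE (k 0) (k 1) (k 2) (k 3).
by elim/forall_I4.
Qed.

Lemma mdeg_exponent a b d e : mdeg (exponent a b d e) = (a + b + d + e)%N.
Proof.
have [k0 k1 k2 k3] := exponentE a b d e.
rewrite mdegE !big_ord_recl big_ord0 addn0 -!addnA.
by congr (_ + (_ + (_ + _)))%N.
Qed.

(** [K a b d e] stands for the coefficient of [x^a y^b xi^d eta^e] in a form of
    degree [n] killed by [x d/dxi + y d/deta] and [xi d/dx + eta d/dy], of which
    the hypotheses are the expansions. *)
Section Recurrence.
Variables (n : nat) (K : nat -> nat -> nat -> nat -> C).
Hypothesis raise0 : forall a b d e, (a + b + d + e = n)%N ->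
  (if a is a'.+1 then K a' b d.+1 e *+ d.+1 else 0)
  + (if b is b'.+1 then K a b' d e.+1 *+ e.+1 else 0) = 0.
Hypothesis lower0 : forall a b d e, (a + b + d + e = n)%N ->
  (if d is d'.+1 then K a.+1 b d' e *+ a.+1 else 0)
  + (if e is e'.+1 then K a b.+1 d e' *+ b.+1 else 0) = 0.

Lemma mulrSn_eq0 (x : C) k : x *+ k.+1 = 0 -> x = 0.
Proof. by move/eqP; rewrite mulrn_eq0 => /eqP. Qed.

(** Both equations relate [K a.+1 0 0 e.+1] to [K a 1 1 e], one with the factor
    [e.+1] and the other with [a.+1]. *)
Lemma extremal_weight0 a e : (a + e = n)%N -> a != e -> K a 0 0 e = 0.
Proof.
case: a e => [|a] [|e] // aen ae.
- have := @raise0 0 1 0 e; rewrite /= add0r => H.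
  by apply: (@mulrSn_eq0 _ e); apply: H; rewrite -aen; lia.
- have := @lower0 a 0 1 0; rewrite /= addr0 => H.
  by apply: (@mulrSn_eq0 _ a); apply: H; rewrite -aen; lia.
have /= := @raise0 a.+1 1 0 e; have /= := @lower0 a 0 1 e.+1.
have -> : (a + 0 + 1 + e.+1 = n)%N by lia.
have -> : (a.+1 + 1 + 0 + e = n)%N by lia.
move=> /(_ erefl) h1 /(_ erefl) h2.
have : K a.+1 0%N 0%N e.+1 * (a.+1%:R - e.+1%:R) = 0.
  rewrite mulrBr !mulr_natr; apply/eqP; rewrite subr_eq0; apply/eqP.
  apply: (addIr (K a 1%N 1%N e *+ 1)); rewrite h1 -h2 addrC //.
move/eqP; rewrite mulf_eq0 subr_eq0 eqr_nat => /orP[/eqP//|].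
by rewrite (negbTE ae).
Qed.

(** Induction on the exponent of [y]: a coefficient with [b > 0] or [d > 0]
    occurs in one of the equations, either alone or with one whose exponent of
    [y] is smaller. *)
Lemma invariant_eq0 : (forall a e, (a + e = n)%N -> K a 0 0 e = 0) ->
  forall a b d e, (a + b + d + e = n)%N -> K a b d e = 0.
Proof.
move=> K0 a b; elim: b a => [|b IHb] a [|d] e.
- by move=> aen; apply: K0; lia.
- move=> aen; have := @raise0 a.+1 0 d e; rewrite /= addr0 => H.
  by apply: (@mulrSn_eq0 _ d); apply: H; lia.
- move=> aen; have := @lower0 a b 0 e.+1; rewrite /= add0r => H.
  by apply: (@mulrSn_eq0 _ b); apply: H; lia.
move=> aen; have /= := @raise0 a.+1 b.+1 d e.
rewrite [K a.+1 b d e.+1]IHb ?mul0rn ?addr0; last lia.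
by move=> H; apply: (@mulrSn_eq0 _ d); apply: H; lia.
Qed.

End Recurrence.

Lemma pcoef_var_deriv i j (k : multinom 4) f : pcoef k (var i * pderiv j f) =
  if k i == 0%N then 0 else
  pcoef (mnm_add (mnm_sub k (mnm1 i)) (mnm1 j)) f *+ (mnm_sub k (mnm1 i) j).+1.
Proof. by rewrite pcoef_varM pcoef_deriv. Qed.

Lemma exponent_eq (k : multinom 4) a b d e :
  k 0 = a -> k 1 = b -> k 2 = d -> k 3 = e -> k = exponent a b d e.
Proof. by move=> <- <- <- <-; exact: exponentP. Qed.

Lemma pcoef_raise f a b d e :
  pcoef (exponent a b d e) (var 0 * pderiv 2 f + var 1 * pderiv 3 f) =
  (if a is a'.+1 then pcoef (exponent a' b d.+1 e) f *+ d.+1 else 0)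
  + (if b is b'.+1 then pcoef (exponent a b' d e.+1) f *+ e.+1 else 0).
Proof.
have [k0 k1 k2 k3] := exponentE a b d e.
rewrite raddfD /= !pcoef_var_deriv k0 k1 !mnmBE !mnm1E k2 k3 /= !subn0.
move: (exponent a b d e) k0 k1 k2 k3 => k k0 k1 k2 k3.
by congr (_ + _); [case: a k0|case: b k1] => //= l kl; congr (pcoef _ _ *+ _);
  apply: exponent_eq; rewrite mnmDE mnmBE !mnm1E ?k0 ?k1 ?k2 ?k3 ?kl /= ?subn0 ?addn0 ?addn1 ?subn1.
Qed.

Lemma pcoef_lower f a b d e :
  pcoef (exponent a b d e) (var 2 * pderiv 0 f + var 3 * pderiv 1 f) =
  (if d is d'.+1 then pcoef (exponent a.+1 b d' e) f *+ a.+1 else 0)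
  + (if e is e'.+1 then pcoef (exponent a b.+1 d e') f *+ b.+1 else 0).
Proof.
have [k0 k1 k2 k3] := exponentE a b d e.
rewrite raddfD /= !pcoef_var_deriv k2 k3 !mnmBE !mnm1E k0 k1 /= !subn0.
move: (exponent a b d e) k0 k1 k2 k3 => k k0 k1 k2 k3.
by congr (_ + _); [case: d k2|case: e k3] => //= l kl; congr (pcoef _ _ *+ _);
  apply: exponent_eq; rewrite mnmDE mnmBE !mnm1E ?k0 ?k1 ?k2 ?k3 ?kl /= ?subn0 ?addn0 ?addn1 ?subn1.
Qed.

Section InvariantForms.
Variables (n : nat) (f : A).
Hypothesis raise_f : forall k, mdeg k = n ->
  pcoef k (var 0 * pderiv 2 f + var 1 * pderiv 3 f) = 0.
Hypothesis lower_f : forall k, mdeg k = n ->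
  pcoef k (var 2 * pderiv 0 f + var 3 * pderiv 1 f) = 0.

Lemma invariant_weight a e : (a + e = n)%N -> a != e -> pcoef (exponent a 0 0 e) f = 0.
Proof.
apply: (@extremal_weight0 n (fun a b d e => pcoef (exponent a b d e) f)) => {}a b d {}e abde.
  by rewrite -pcoef_raise raise_f// mdeg_exponent.
by rewrite -pcoef_lower lower_f// mdeg_exponent.
Qed.

Lemma invariant_top : (forall a e, (a + e = n)%N -> pcoef (exponent a 0 0 e) f = 0) ->
  forall k, mdeg k = n -> pcoef k f = 0.
Proof.
move=> f0 k; rewrite (exponentP k) mdeg_exponent.
apply: (@invariant_eq0 n (fun a b d e => pcoef (exponent a b d e) f)) => // a b d e abde.
  by rewrite -pcoef_raise raise_f// mdeg_exponent.
by rewrite -pcoef_lower lower_f// mdeg_exponent.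
Qed.

End InvariantForms.

End Invariants.

(** * The centraliser of the triple *)

Section Centraliser.
Variables (R : realType) (m : nat) (c : 'M[R]_2 -> R[i]) (eps : R).
Hypothesis c_inv : conj_invariant m c.
Local Notation C := R[i].
Local Notation G := (dihedral R m).
Local Notation H := (cherednik m c).
Variable A : polynomial_ring C.
Local Notation grpH := (@grpH R m c).
Local Notation vecH := (@vecH R m c).
Local Notation letter := (@letter R m c).
Local Notation filtration := (@filtration R m c).
Local Notation linear_closed := (@Defs.linear_closed R m c).
Local Notation linear_span := (@Defs.linear_span R m c).
Local Notation normal_form := (@normal_form R m c A).
Local Notation has_symbol := (@has_symbol R m c A).
Local Notation scal := (@scal C A).
Local Notation var := (@var C A).
Local Notation pcoef := (@pcoef C A).
Local Notation pderiv := (@pderiv C A).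
Local Notation Eplus := (@Eplus R m c).
Local Notation Eminus := (@Eminus R m c).
Local Notation Z0 := (@Z0 R m c).
Implicit Types (a b : C) (g : G) (h z : H) (f : A) (n : nat) (k : multinom 4).

Lemma linear_formN v : linear_form A (- v) = - linear_form A v.
Proof.
rewrite -[LHS]/(coordinate A (- v.2) + momentum A (- v.1)).
by rewrite coordinateN momentumN -opprD.
Qed.

Lemma linear_form0 : linear_form A 0 = 0.
Proof.
rewrite -[LHS]/(coordinate A 0 + momentum A 0) /coordinate /momentum !mxE.
by rewrite rmorph0 !mul0r !addr0.
Qed.

Lemma raise_symbol f :
  symbol_derivation (@raise R) f = - (var 0 * pderiv 2 f + var 1 * pderiv 3 f).
Proof.
rewrite /symbol_derivation sum_I4 /raise /= linear_form0 !linear_formN !mul0r !add0r.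
have -> : linear_form A (inEdual (xE R)) = var 0 by exact: (linear_form_letter A 0).
have -> : linear_form A (inEdual (yE R)) = var 1 by exact: (linear_form_letter A 1).
by rewrite !mulNr opprD.
Qed.

Lemma lower_symbol f :
  symbol_derivation (@lower R) f = - (var 2 * pderiv 0 f + var 3 * pderiv 1 f).
Proof.
rewrite /symbol_derivation sum_I4 /lower /= linear_form0 !linear_formN !mul0r !addr0.
have -> : linear_form A (Defs.inE (xiE R)) = var 2 by exact: (linear_form_letter A 2).
have -> : linear_form A (Defs.inE (etaE R)) = var 3 by exact: (linear_form_letter A 3).
by rewrite !mulNr opprD.
Qed.

Lemma centraliser_symbol (E : H) (s : 'I_4 -> phase R) n h g k :
  (forall i, E * letter i - letter i * E = vecH (s i)) ->
  (forall g, grpH g * E = E * grpH g) ->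
  filtration n.+1 h -> GRing.comm h E -> mdeg k = n ->
  pcoef k (symbol_derivation s (normal_form h g)) = 0.
Proof.
move=> El Eg hn hE kn.
have /(_ k) := @bracket_symbol R m c c_inv A E s El (fun g => esym (Eg g)) n h g hn.
by rewrite hE subrr normal_form0// sub0r raddfN kn => /(_ (leqnn _))/eqP; rewrite oppr_eq0 => /eqP.
Qed.

Definition sl2_central h := GRing.comm h Eplus /\ GRing.comm h Eminus.

Lemma sl2_central_raise n h g k : filtration n.+1 h -> sl2_central h -> mdeg k = n ->
  pcoef k (var 0 * pderiv 2 (normal_form h g) + var 1 * pderiv 3 (normal_form h g)) = 0.
Proof.
move=> hn [hp _] kn.
have := centraliser_symbol g (@Eplus_letter R m c) (@grp_Eplus R m c) hn hp kn.
by rewrite raise_symbol raddfN => /eqP; rewrite oppr_eq0 => /eqP.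
Qed.

Lemma sl2_central_lower n h g k : filtration n.+1 h -> sl2_central h -> mdeg k = n ->
  pcoef k (var 2 * pderiv 0 (normal_form h g) + var 3 * pderiv 1 (normal_form h g)) = 0.
Proof.
move=> hn [_ hp] kn.
have := centraliser_symbol g (@Eminus_letter R m c) (@grp_Eminus R m c) hn hp kn.
by rewrite lower_symbol raddfN => /eqP; rewrite oppr_eq0 => /eqP.
Qed.

Definition Z0_symbol : A := scal 'i * (var 0 * var 3 - var 1 * var 2).

Lemma has_symbol_Z0 n h f : has_symbol n h f -> has_symbol n.+2 (Z0 * h) (Z0_symbol * f).
Proof.
move=> hf; rewrite /Defs.Z0 /Z0_symbol scaleMl -mulrA.
apply: has_symbolZ => //; rewrite !mulrBl -!mulrA.
have lt i h' f' n' : has_symbol n' h' f' -> has_symbol n'.+1 (letter i * h') (var i * f').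
  by move=> hf'; rewrite -(linear_form_letter A i); exact: has_symbol_vec.
apply: has_symbolD => //; first exact: (lt 0 _ _ _ (lt 3 _ _ _ hf)).
apply: has_symbolN => //; exact: (lt 1 _ _ _ (lt 2 _ _ _ hf)).
Qed.

Lemma has_symbol_Z0X n : has_symbol n.*2 (Z0 ^+ n) (Z0_symbol ^+ n).
Proof.
elim: n => [|n IHn]; first by rewrite !expr0; exact: has_symbol1.
by rewrite !exprS doubleS; exact: has_symbol_Z0.
Qed.

Lemma pcoef_Z0_symbol n : pcoef (exponent n 0 0 n) (Z0_symbol ^+ n) = 'i ^+ n.
Proof.
elim: n => [|n IHn].
  rewrite !expr0 pcoef_1 (_ : exponent 0 0 0 0 = mnm0) ?eqxx//.
  apply/mnmP; have [k0 k1 k2 k3] := exponentE 0 0 0 0.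
  by elim/forall_I4; rewrite mnm0E.
rewrite !exprS {1}/Z0_symbol -mulrA pcoef_scalM mulrBl raddfB /= -!mulrA.
have [k0 k1 k2 k3] := exponentE n.+1 0 0 n.+1.
rewrite !pcoef_varM k0 k1 /= subr0 mnmBE mnm1E k3 /=.
rewrite (_ : mnm_sub _ _ = exponent n 0 0 n) ?IHn//.
by apply: exponent_eq; rewrite !mnmBE !mnm1E ?k0 ?k1 ?k2 ?k3 /= ?subn0 ?subn1.
Qed.

Lemma sl2_centralB h z : sl2_central h -> sl2_central z -> sl2_central (h - z).
Proof.
by move=> [hp hm] [zp zm]; split; apply/commr_sym/commrB; exact: commr_sym.
Qed.

Lemma group_comm (E : H) z : (forall g, grpH g * E = E * grpH g) ->
  filtration 1 z -> GRing.comm z E.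
Proof.
move=> Eg; apply: (filtration_ind (S := fun z => GRing.comm z E)).
  split=> [|a u v Hu Hv]; first exact/commr_sym/commr0.
  by rewrite /GRing.comm mulrDl mulrDr scaleMl scaleMr Hu Hv.
by move=> g [|//] _; rewrite wordH_nil mulr1; exact: Eg.
Qed.

Lemma sl2_central_group z n : filtration 1 z -> sl2_central (z * Z0 ^+ n).
Proof.
move=> z1; split; apply/commr_sym/commrM; apply/commr_sym.
- by apply: group_comm => //; exact: grp_Eplus.
- exact/commr_sym/commrX/commr_sym/comm_Z0_Eplus.
- by apply: group_comm => //; exact: grp_Eminus.
- exact/commr_sym/commrX/commr_sym/comm_Z0_Eminus.
Qed.

Lemma filtration_Z0X n : filtration n.*2.+1 (Z0 ^+ n).
Proof.
have Z2 : filtration 3 Z0.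
  have L i j : filtration 3 (letter i * letter j).
    rewrite -[_ * _]mulr1 -(grpH1 m c) -mulrA.
    by do 2!apply: filtration_vecM; exact: filtration_grp.
  by rewrite /Defs.Z0; apply: filtrationZ; apply: filtrationB; [exact: (L 0 3)|exact: (L 1 2)].
elim: n => [|n IHn]; first by rewrite expr0 -(grpH1 m c); exact: filtration_grp.
by rewrite exprS doubleS; exact: (filtrationM Z2 IHn).
Qed.

Definition Z0_polys n : set H := linear_span
  [set h | exists z, exists2 l, filtration 1 z & (l < n)%N /\ h = z * Z0 ^+ l].

Lemma Z0_polys_closed n : linear_closed (Z0_polys n).
Proof. exact: linear_span_closed. Qed.

Lemma Z0_polys_ind n (S : set H) : linear_closed S ->
  (forall z l, filtration 1 z -> (l < n)%N -> S (z * Z0 ^+ l)) ->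
  forall h, Z0_polys n h -> S h.
Proof.
by move=> Scl SW h; apply; split=> // _ [z [l z1 [ln ->]]]; exact: SW.
Qed.

Lemma Z0_polys_monomial n z l : filtration 1 z -> (l < n)%N -> Z0_polys n (z * Z0 ^+ l).
Proof. by move=> z1 ln S [_]; apply; exists z, l. Qed.

Lemma Z0_polys0 n : Z0_polys n 0.
Proof. by have [] := Z0_polys_closed n. Qed.

Lemma Z0_polysP n a u v : Z0_polys n u -> Z0_polys n v -> Z0_polys n (a *: u + v).
Proof. by have [_] := Z0_polys_closed n; apply. Qed.

Lemma Z0_polysD n u v : Z0_polys n u -> Z0_polys n v -> Z0_polys n (u + v).
Proof. by rewrite -{2}[u]scale1r; exact: Z0_polysP. Qed.

Lemma Z0_polysZ n a u : Z0_polys n u -> Z0_polys n (a *: u).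
Proof. by move=> un; rewrite -[_ *: _]addr0; apply: Z0_polysP => //; exact: Z0_polys0. Qed.

Lemma Z0_polysB n u v : Z0_polys n u -> Z0_polys n v -> Z0_polys n (u - v).
Proof. by move=> un vn; rewrite -scaleN1r addrC; exact: Z0_polysP. Qed.

Lemma Z0_polysW n l h : (n <= l)%N -> Z0_polys n h -> Z0_polys l h.
Proof.
move=> nl; apply: Z0_polys_ind; first exact: Z0_polys_closed.
by move=> z k z1 kn; apply: Z0_polys_monomial => //; exact: leq_trans nl.
Qed.

(** A noncommutative form of the first fundamental theorem of invariants for
    [SL_2], by induction on the degree. The part of degree [n] of [h] is
    zero if [n] is odd, and determined by its coefficient of [x^l eta^l] if
    [n = 2 l]; subtracting a multiple of [Z0 ^+ l] cancels the latter. *)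
Lemma sl2_central_Z0_polys n h : filtration n h -> sl2_central h -> Z0_polys n h.
Proof.
elim: n h => [|n IHn] h hn hc; first by rewrite (filtration_eq0 hn); exact: Z0_polys0.
suff [z z1 [hz hz0]] : exists2 z, filtration 1 z & filtration n.+1 (z * Z0 ^+ n./2) /\
    forall g (l : nat), (l + l = n)%N ->
      pcoef (exponent l 0 0 l) (normal_form (h - z * Z0 ^+ n./2) g) = 0.
  rewrite -(subrK (z * Z0 ^+ n./2) h); apply: Z0_polysD; last first.
    by apply: Z0_polys_monomial => //; lia.
  have hc' : sl2_central (h - z * Z0 ^+ n./2).
    by apply: sl2_centralB => //; exact: sl2_central_group.
  have hn' : filtration n.+1 (h - z * Z0 ^+ n./2) by exact: filtrationB.
  apply: Z0_polysW (leqnSn n) _; apply: IHn => //.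
  apply: (filtration_top c_inv (A := A)) => // g k.
  have raise0 k' := sl2_central_raise g (k := k') hn' hc'.
  have lower0 k' := sl2_central_lower g (k := k') hn' hc'.
  apply: (invariant_top raise0 lower0) => a e aen.
  have [ae|ae] := eqVneq a e; first by rewrite -ae hz0// -aen ae.
  exact: (invariant_weight raise0 lower0).
have [no|/negbTE ne] := boolP (odd n).
  exists 0; first exact: filtration0.
  rewrite mul0r; split=> [|g l ln]; first exact: filtration0.
  by move: no; rewrite -ln addnn odd_double.
have n2 : n = n./2.*2 by rewrite -[LHS]odd_double_half ne.
set l := n./2 in n2 *.
have ln : mdeg (exponent l 0 0 l) = n by rewrite mdeg_exponent !addn0 addnn.
have [y y1 hy] := top_coefficient c_inv A hn ln.
(* The coefficient of [x^l eta^l] in the symbol of [Z0 ^+ l] is ['i ^+ l]. *)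
have il : 'i ^+ l != 0 :> C by rewrite expf_neq0// neq0Ci.
have y1' : filtration 1 (('i ^+ l)^-1 *: y) by exact: filtrationZ.
exists (('i ^+ l)^-1 *: y) => //; split=> [|g l' l'n].
  by rewrite n2; apply: (filtrationM (n := 0)) => //; exact: filtration_Z0X.
have -> : l' = l by move: n2; rewrite -l'n; lia.
have /(_ (exponent l 0 0 l)) := normal_form_groupM c_inv y1' (has_symbol_Z0X l) g.
rewrite -n2 ln leqnn => /(_ isT)/eqP; rewrite raddfB /= subr_eq0 => /eqP E.
rewrite normal_formB// !fctE raddfB /= E.
have [b yb] := normal_form_group c_inv A g y1.
rewrite normal_formZ// scaleME hy yb -rmorphM !pcoef_scalM pcoef_Z0_symbol.
rewrite -[scal b]mulr1 pcoef_scalM pcoef_1 eqxx mulr1.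
by rewrite mulrAC mulVf// mul1r subrr.
Qed.

(** * Commutation with the deformed central element *)

Local Notation sigma := (@sigma R m c).
Local Notation Zt := (Ztilde m c eps).
Local Notation GJ := (group_algebra_GJ m c).

Lemma group_algebra_GJ_ind (S : set H) : linear_closed S ->
  (forall g, val g *m cplxJ R = cplxJ R *m val g -> S (grpH g)) ->
  forall h, GJ h -> S h.
Proof. by move=> Scl Sg h; apply; split=> // _ [g gJ ->]; exact: Sg. Qed.

Lemma group_algebra_GJ_closed : linear_closed GJ.
Proof. exact: linear_span_closed. Qed.

Lemma comm_closed h : linear_closed (fun r => GRing.comm r h).
Proof.
split=> [|a u v Hu Hv]; first exact/commr_sym/commr0.
by rewrite /GRing.comm mulrDl mulrDr scaleMl scaleMr Hu Hv.
Qed.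

Lemma filtration_GJ r : GJ r -> filtration 1 r.
Proof.
apply: group_algebra_GJ_ind; first exact: filtration_closed.
by move=> g _; exact: filtration_grp.
Qed.

Lemma comm_GJ_Z0 r : GJ r -> GRing.comm r Z0.
Proof.
apply: (group_algebra_GJ_ind (S := fun r => GRing.comm r Z0)); first exact: comm_closed.
move=> g gJ; have [e _ [/iffLR/(_ gJ) -> gZ]] := grp_Z0 c g.
by rewrite /GRing.comm gZ rmorph1 scale1r.
Qed.

Lemma comm_GJ_sigma r : GJ r -> GRing.comm r sigma.
Proof.
apply: (group_algebra_GJ_ind (S := fun r => GRing.comm r sigma)); first exact: comm_closed.
by move=> g _; exact: grp_sigma.
Qed.

Lemma comm_GJ_Ztilde r : GJ r -> GRing.comm r Zt.
Proof.
move=> rJ; apply: commrD; first exact: comm_GJ_Z0.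
by rewrite /GRing.comm scaleMr scaleMl comm_GJ_sigma.
Qed.

(** [G] consists of rotations, which commute with [Z0], and of reflections,
    which anticommute with it. *)
Lemma group_split z : filtration 1 z -> exists2 r, GJ r &
  exists2 f, filtration 1 f /\ Z0 * f = - (f * Z0) & z = r + f.
Proof.
pose S z := exists2 r, GJ r & exists2 f, filtration 1 f /\ Z0 * f = - (f * Z0) & z = r + f.
apply: (filtration_ind (S := S)).
  split=> [|a u v [r rJ [f [f1 fZ] ->]] [r' rJ' [f' [f1' fZ'] ->]]].
    exists 0; first by have [] := group_algebra_GJ_closed.
    by exists 0; rewrite ?addr0// mulr0 mul0r oppr0; split=> //; exact: filtration0.
  exists (a *: r + r'); first by have [_] := group_algebra_GJ_closed; apply.
  exists (a *: f + f'); last by rewrite scalerDr addrACA.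
  split; first exact: filtrationP.
  by rewrite mulrDl mulrDr scaleMl scaleMr fZ fZ' scalerN opprD.
move=> g [|//] _; rewrite wordH_nil mulr1.
have [e e1 [gJ gZ]] := grp_Z0 c g.
have [e_1|e_1] := sqr1_cases e1.
  exists (grpH g); first by move=> T [_]; apply; exists g => //; apply/gJ.
  by exists 0; rewrite ?addr0// mulr0 mul0r oppr0; split=> //; exact: filtration0.
exists 0; first by have [] := group_algebra_GJ_closed.
exists (grpH g); rewrite ?add0r//; split; first exact: filtration_grp.
by rewrite gZ e_1 rmorphN1 scaleN1r opprK.
Qed.

Lemma filtration_sigma : filtration 1 sigma.
Proof. by apply: filtration_sum => j; apply: filtrationZ; exact: filtration_grp. Qed.

Lemma Z0_polys_groupM n z h : filtration 1 z -> Z0_polys n h -> Z0_polys n (z * h).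
Proof.
move=> z1; apply: (Z0_polys_ind (S := fun h => Z0_polys n (z * h))).
  split=> [|a u v Hu Hv]; first by rewrite mulr0; exact: Z0_polys0.
  by rewrite mulrDr scaleMr; exact: Z0_polysP.
move=> y l y1 ln; rewrite mulrA; apply: Z0_polys_monomial => //.
exact: (@filtrationM _ _ _ 0 1).
Qed.

Lemma Z0_twist z : filtration 1 z -> exists2 y, filtration 1 y & Z0 * z = y * Z0.
Proof.
move=> /group_split[r rJ [f [f1 fZ] ->]]; exists (r - f).
  by apply: filtrationB => //; exact: filtration_GJ.
by rewrite mulrDr mulrBl fZ (comm_GJ_Z0 rJ).
Qed.

Lemma Z0X_twist n z : filtration 1 z -> exists2 y, filtration 1 y & Z0 ^+ n * z = y * Z0 ^+ n.
Proof.
elim: n z => [|n IHn] z z1; first by exists z; rewrite // !expr0 mulr1 mul1r.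
have [y y1 E] := Z0_twist z1; have [x x1 E'] := IHn y y1.
by exists x; rewrite // !exprSr -mulrA E !mulrA E'.
Qed.

Lemma Z0_polysMZ0 n h : Z0_polys n h -> Z0_polys n.+1 (h * Z0).
Proof.
apply: (Z0_polys_ind (S := fun h => Z0_polys n.+1 (h * Z0))).
  split=> [|a u v Hu Hv]; first by rewrite mul0r; exact: Z0_polys0.
  by rewrite mulrDl scaleMl; exact: Z0_polysP.
by move=> z l z1 ln; rewrite -mulrA -exprSr; exact: Z0_polys_monomial.
Qed.

Lemma Z0M_Z0_polys n h : Z0_polys n h -> Z0_polys n.+1 (Z0 * h).
Proof.
apply: (Z0_polys_ind (S := fun h => Z0_polys n.+1 (Z0 * h))).
  split=> [|a u v Hu Hv]; first by rewrite mulr0; exact: Z0_polys0.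
  by rewrite mulrDr scaleMr; exact: Z0_polysP.
move=> z l z1 ln; have [y y1 E] := Z0_twist z1.
by rewrite mulrA E -mulrA -exprS; exact: Z0_polys_monomial.
Qed.

Lemma Z0_polysM_group n h z : filtration 1 z -> Z0_polys n h -> Z0_polys n (h * z).
Proof.
move=> z1; apply: (Z0_polys_ind (S := fun h => Z0_polys n (h * z))).
  split=> [|a u v Hu Hv]; first by rewrite mul0r; exact: Z0_polys0.
  by rewrite mulrDl scaleMl; exact: Z0_polysP.
move=> y l y1 ln; have [x x1 E] := Z0X_twist l z1.
rewrite -mulrA E mulrA; apply: Z0_polys_monomial => //.
exact: (@filtrationM _ _ _ 0 1).
Qed.

Lemma Ztilde_expansion n : Z0_polys n (Zt ^+ n - Z0 ^+ n).
Proof.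
elim: n => [|n IHn]; first by rewrite !expr0 subrr; exact: Z0_polys0.
have -> : Zt ^+ n.+1 - Z0 ^+ n.+1 = Z0 * (Zt ^+ n - Z0 ^+ n)
    + eps%:C *: (sigma * (Zt ^+ n - Z0 ^+ n)) + eps%:C *: (sigma * Z0 ^+ n).
  rewrite !exprS; set w := Zt ^+ n; set v := Z0 ^+ n.
  by rewrite /Ztilde mulrDl scaleMl -[RHS]addrA -scalerDr -mulrDr subrK mulrBr addrAC.
apply: Z0_polysD; last first.
  by apply: Z0_polysZ; apply: Z0_polys_monomial => //; exact: filtration_sigma.
apply: Z0_polysD; first exact: Z0M_Z0_polys.
apply: (Z0_polysW (leqnSn n)); apply: Z0_polysZ; apply: Z0_polys_groupM => //.
exact: filtration_sigma.
Qed.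

(** The powers of [Z0] are independent over the group algebra, because of
    their degrees: the coefficient of [x^n eta^n] in [Z0 ^+ n] is not zero, and
    the lower powers have degree less than [2 n]. *)
Lemma Z0_polys_independent n z : filtration 1 z -> Z0_polys n (z * Z0 ^+ n) -> z = 0.
Proof.
move=> z1 zn; apply: (group_coef_inj c_inv (A := A) z1) => g.
have zf : filtration n.*2 (z * Z0 ^+ n).
  move: zn; apply: Z0_polys_ind; first exact: filtration_closed.
  move=> y l y1 ln; apply: (@filtrationW _ _ _ (0 + l.*2.+1)); first by lia.
  by apply: filtrationM => //; exact: filtration_Z0X.
have en : mdeg (exponent n 0 0 n) = n.*2 by rewrite mdeg_exponent !addn0 addnn.
have := deg_lt_filtration c_inv A (invG g) zf.
have /(_ (exponent n 0 0 n)) := normal_form_groupM c_inv z1 (has_symbol_Z0X n) (invG g).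
rewrite en leqnn => /(_ isT)/eqP; rewrite raddfB /= subr_eq0 => /eqP E.
move=> /(_ (exponent n 0 0 n)); rewrite en leqnn => /(_ isT); rewrite E.
rewrite (group_coefP c_inv)// pcoef_scalM pcoef_Z0_symbol => /eqP.
by rewrite mulf_eq0 expf_eq0 (negbTE (neq0Ci _)) andbF orbF => /eqP.
Qed.

Lemma Z0_polys_top n h : Z0_polys n.+1 h ->
  exists2 z, filtration 1 z & Z0_polys n (h - z * Z0 ^+ n).
Proof.
apply: (Z0_polys_ind (S := fun h => exists2 z, filtration 1 z & Z0_polys n (h - z * Z0 ^+ n))).
  split=> [|a u v [z z1 zu] [y y1 yv]].
    by exists 0; rewrite ?mul0r ?subrr; [exact: filtration0|exact: Z0_polys0].
  exists (a *: z + y); first exact: filtrationP.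
  by rewrite mulrDl scaleMl opprD addrACA -scalerBr; exact: Z0_polysP.
move=> z l z1; rewrite ltnS leq_eqVlt => /orP[/eqP->|ln].
  by exists z; rewrite ?subrr//; exact: Z0_polys0.
by exists 0; rewrite ?mul0r ?subr0; [exact: filtration0|exact: Z0_polys_monomial].
Qed.

Lemma subalgebra_generated (S : set H) : subalgebra (generated_algebra S).
Proof.
split; first split.
- by move=> T [[[]]].
- move=> a u v Hu Hv T HT; have [[[_ TD] _ _] _] := HT.
  by apply: TD; [exact: Hu|exact: Hv].
- by move=> T [[]].
- move=> u v Hu Hv T HT; have [[_ _ TM] _] := HT.
  by apply: TM; [exact: Hu|exact: Hv].
Qed.

(** By induction on the degree in [Z0]. In the bracket of [h] with [Zt] the
    leading term is, up to sign, twice the part of [z] on reflections, times [Z0 ^+ n.+1], so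
    that this part vanishes; the part on rotations is removed by subtracting its
    product with [Zt ^+ n], which stays within the centraliser. *)
Lemma Ztilde_central_generated n h : Z0_polys n h -> GRing.comm h Zt ->
  generated_algebra ([set Zt] `|` GJ) h.
Proof.
have [[gen0 genP] gen1 genM] := subalgebra_generated ([set Zt] `|` GJ).
elim: n h => [|n IHn] h hn hZ.
  suff -> : h = 0 by exact: gen0.
  move: hn; apply: (Z0_polys_ind (S := [set 0])) => //.
  by split=> [//|a u v -> ->]; rewrite /= scaler0 addr0.
have [z /group_split[r rJ [f [f1 fZ] zE]] hz] := Z0_polys_top hn.
have r1 := filtration_GJ rJ.
set h1 := h - z * Z0 ^+ n in hz.
have hE : h = z * Z0 ^+ n + h1 by rewrite addrC subrK.
have f0 : f = 0.
  apply: (@Z0_polys_independent n.+1) => //.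
  have B : Z0 * h - h * Z0 = - (f * Z0 ^+ n.+1 + f * Z0 ^+ n.+1) + (Z0 * h1 - h1 * Z0).
    rewrite {1 2}hE mulrDr mulrDl opprD addrACA; congr (_ + _).
    rewrite mulrA zE mulrDr -(comm_GJ_Z0 rJ) fZ -mulrBl -!mulrA -exprS -exprSr.
    by rewrite mulrBl mulrDl opprD addrACA subrr add0r -opprD.
  have E : f * Z0 ^+ n.+1 + f * Z0 ^+ n.+1 =
      (Z0 * h1 - h1 * Z0) + eps%:C *: (sigma * h - h * sigma).
    apply/eqP; rewrite -subr_eq0 -opprB oppr_eq0 addrAC [X in X + _]addrC -B.
    rewrite scalerBr -scaleMl -scaleMr addrACA -opprD -mulrDl -mulrDr.
    by rewrite subr_eq0; apply/eqP/esym.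
  have -> : f * Z0 ^+ n.+1 = 2^-1 *: (f * Z0 ^+ n.+1 + f * Z0 ^+ n.+1).
    by rewrite -mulr2n -(scaler_nat 2 (f * Z0 ^+ n.+1)) scale_halfK.
  rewrite E; apply: Z0_polysZ.
  apply: Z0_polysD.
    by apply: Z0_polysB; [exact: Z0M_Z0_polys|exact: Z0_polysMZ0].
  apply: Z0_polysZ; apply: Z0_polysB.
    by apply: Z0_polys_groupM => //; exact: filtration_sigma.
  by apply: Z0_polysM_group => //; exact: filtration_sigma.
have rZt : generated_algebra ([set Zt] `|` GJ) (r * Zt ^+ n).
  apply: (genM); first by move=> T [_]; apply; right.
  elim: n {IHn hn h1 hz hE} => [|n IHn]; first by rewrite expr0.
  by rewrite exprS; apply: (genM) => // T [_]; apply; left.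
rewrite -(subrK (r * Zt ^+ n) h) -[X in X + _]scale1r; apply: genP => //.
apply: IHn; last first.
  apply/commr_sym/commrB; first exact: commr_sym.
  apply: commrM; first exact/commr_sym/comm_GJ_Ztilde.
  exact/commrX.
have -> : h - r * Zt ^+ n = h1 - r * (Zt ^+ n - Z0 ^+ n).
  by rewrite mulrBr /h1 zE f0 addr0 opprB addrA subrK.
apply: Z0_polysB => //; apply: Z0_polys_groupM => //; exact: Ztilde_expansion.
Qed.

(** Commutation with [Hweight] is automatic, this being a bracket. *)
Lemma sl2_central_centraliser h : GRing.comm h Zt -> sl2_central h ->
  centraliser (u11 m c eps) h.
Proof.
move=> hZ [hp hm] _ [a [b [d [e ->]]]].
have S t (x : H) : GRing.comm h x -> GRing.comm h (t *: x).
  by move=> hx; rewrite /GRing.comm scaleMr scaleMl hx.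
by do ![apply: commrD]; apply: S => //; rewrite Hweight_bracket;
  apply: commrB; apply: commrM.
Qed.

Lemma centraliser_sl2_central h : centraliser (u11 m c eps) h ->
  GRing.comm h Zt /\ sl2_central h.
Proof.
move=> hC; split; last split; apply: hC.
- by exists 0, 0, 0, 1; rewrite rmorph0 rmorph1 !scale0r scale1r !add0r.
- by exists 1, 0, 0, 0; rewrite rmorph0 rmorph1 !scale0r scale1r !addr0.
- by exists 0, 1, 0, 0; rewrite rmorph0 rmorph1 !scale0r scale1r !addr0 add0r.
Qed.

Lemma subalgebra_centraliser (S : set H) : subalgebra (centraliser S).
Proof.
split; first split.
- by move=> u _; exact/commr_sym/commr0.
- by move=> a u v Hu Hv w Sw; have [_] := comm_closed w; apply; [exact: Hu|exact: Hv].
- by move=> u _; exact/commr_sym/commr1.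
- by move=> u v Hu Hv w Sw; apply/commr_sym/commrM; apply/commr_sym; [exact: Hu|exact: Hv].
Qed.

Lemma comm_Ztilde_E (E : H) : GRing.comm Z0 E -> (forall g, grpH g * E = E * grpH g) ->
  GRing.comm Zt E.
Proof.
move=> ZE gE; apply/commr_sym/commrD; first exact: commr_sym.
have sE := group_comm gE filtration_sigma.
by rewrite /GRing.comm scaleMl scaleMr sE.
Qed.

Theorem centraliser_u11 :
  centraliser (u11 m c eps) = generated_algebra ([set Zt] `|` GJ).
Proof.
apply/seteqP; split=> [h hC|].
  have [hZ hc] := centraliser_sl2_central hC.
  have [n hn] := filtration_exhaustive h.
  exact: (Ztilde_central_generated (sl2_central_Z0_polys hn hc)).
move=> h hg; apply: (hg (centraliser (u11 m c eps))); split.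
  exact: subalgebra_centraliser.
move=> r [->|rJ]; apply: sl2_central_centraliser.
- by [].
- split; apply: comm_Ztilde_E; [exact: comm_Z0_Eplus|exact: grp_Eplus
    |exact: comm_Z0_Eminus|exact: grp_Eminus].
- exact: comm_GJ_Ztilde.
- have r1 := filtration_GJ rJ.
  by split; apply: group_comm => //; [exact: grp_Eplus|exact: grp_Eminus].
Qed.

End Centraliser.

Theorem proposition4p5 (R : realType) (m : nat) (c : 'M[R]_2 -> R[i]) (eps : R)
    (m_gt0 : (0 < m)%N) (c_inv : conj_invariant m c) :
  centraliser (u11 m c eps) =
  generated_algebra ([set Ztilde m c eps] `|` group_algebra_GJ m c).
Proof. exact: (centraliser_u11 eps c_inv (mpoly_polynomial_ring _)). Qed.
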